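(* Let $\mathbb{K}$ and $\mathbb{L}$ be countably infinite fields such that $\mathbb{K}^*$ and $\mathbb{L}^*$ are isomorphic as groups. Let $\rho : \mathbb{K}^* \to \mathbb{L}^*$ be an isomorphism, and suppose that the ergodic $\mathbb{K}^*$-actions $$\mathbb{K}^* \curvearrowright (\widehat{\mathbb{K}}, m_{\widehat{\mathbb{K}}}) \quad\text{and}\quad \mathbb{K}^* \curvearrowright_\rho (\widehat{\mathbb{L}}, m_{\widehat{\mathbb{L}}}),$$ where $\mathbb{K}^*$ acts on $\widehat{\mathbb{L}}$ via $\rho$, are not disjoint. Then $\mathbb{K}$ and $\mathbb{L}$ are isomorphic as fields. More precisely, there exists a homomorphism $w : \mathbb{K}^* \to \mathbb{L}^*$ with finite image such that the map $\kappa : \mathbb{K} \to \mathbb{L}$ defined by $$\kappa(0) = 0 \quad\text{and}\quad \kappa(x) = w(x)\rho(x) \quad\text{for all } x \in \mathbb{K}\setminus\{0\}$$ is a field isomorphism. Furthermore, any non-trivial $\mathbb{K}^*$-invariant and $\mathbb{K}^*$-ergodic coupling of the $\mathbb{K}^*$-actions on $(\widehat{\mathbb{K}}, m_{\widehat{\mathbb{K}}})$ and $(\widehat{\mathbb{L}}, m_{\widehat{\mathbb{L}}})$ is of the form $(e,b^* )_*\mu$ for some $b \in \mathbb{L}^*$, where $$\mu(f) = \frac{1}{|\operatorname{Im}(w)|}\sum_{c \in \operatorname{Im}(w)} \int_{\widehat{\mathbb{L}}} f(\kappa^*(\eta), c^*\eta)\, dm_{\widehat{\mathbb{L}}}(\eta),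 \qquad f \in C(\widehat{\mathbb{K}}\times\widehat{\mathbb{L}}),$$ and $\kappa^* : \widehat{\mathbb{L}} \to \widehat{\mathbb{K}}$, $\eta \mapsto \eta\circ\kappa$, denotes the isomorphism between $\widehat{\mathbb{L}}$ and $\widehat{\mathbb{K}}$ induced by $\kappa$.
   Context: For a countably infinite discrete field $\mathbb{K}$, $\widehat{\mathbb{K}} = \operatorname{Hom}((\mathbb{K},+), \mathbb{S}^1)$ is the (compact, metrizable) Pontryagin dual of the additive group, with Haar probability measure $m_{\widehat{\mathbb{K}}}$. For $a \in \mathbb{K}^*$ the automorphism $a^*$ of $\widehat{\mathbb{K}}$ is $(a^*\xi)(b) = \xi(ab)$, $\xi\in\widehat{\mathbb{K}}$, $b \in \mathbb{K}$. The group $\mathbb{K}^*$ acts on $\widehat{\mathbb{K}}$ by $a.\xi = a^*\xi$, and on $\widehat{\mathbb{L}}$ via $\rho$ by $a.\eta = \rho(a)^*\eta$; these actions preserve, and are ergodic for, the Haar probability measures. A coupling is a Borel probability measure on $\widehat{\mathbb{K}}\times\widehat{\mathbb{L}}$ with marginals $m_{\widehat{\mathbb{K}}}$ and $m_{\widehat{\mathbb{L}}}$. It is ($\mathbb{K}^*$-)invariant if it is invariant under the diagonal action $a.(\xi,\eta) = (a^*\xi, \rho(a)^*\eta)$, and $\mathbb{K}^*$-ergodic if it is ergodic for this action. The trivial coupling is $m_{\widehat{\mathbb{K}}}\otimes m_{\widehat{\mathbb{L}}}$; a coupling is non-trivial if it differs from the trivial one. The two actions are disjoint if the trivial coupling is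 the only invariant coupling. The map $(e,b^* )$ on $\widehat{\mathbb{K}}\times\widehat{\mathbb{L}}$ is $(\xi,\eta) \mapsto (\xi, b^*\eta)$. *)

(* Defs.v *)
From HB Require Import structures.
From mathcomp Require Import all_boot all_order all_algebra finmap.
From mathcomp Require Import all_classical all_reals all_analysis.
From mathcomp.real_closed Require Import complex.
From mathcomp Require Import ring lra.

Set Implicit Arguments.
Unset Strict Implicit.
Unset Printing Implicit Defensive.

Import Order.TTheory GRing.Theory Num.Theory.
Import numFieldNormedType.Exports.

Local Open Scope classical_set_scope.
Local Open Scope ring_scope.

Definition units (K : fieldType) : Type := {x : K | x != 0}.

Section units_group.
Variable K : fieldType.

HB.instance Definition _ := SubType.on (units K).
HB.instance Definition _ := Choice.on (units K).

Definition units1 : units K := exist _ 1 (oner_neq0 K).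

Lemma units_mul_subproof (u v : units K) : val u * val v != 0.
Proof. exact: mulf_neq0 (valP u) (valP v). Qed.

Definition units_mul (u v : units K) : units K :=
  exist (fun x => is_true (x != 0)) _ (units_mul_subproof u v).

Lemma units_inv_subproof (u : units K) : (val u)^-1 != 0.
Proof. by rewrite invr_neq0 // (valP u). Qed.

Definition units_inv (u : units K) : units K := exist (fun x => is_true (x != 0)) _ (units_inv_subproof u).

Lemma units_mulA : associative units_mul.
Proof. by move=> u v w; apply/val_inj/mulrA. Qed.

Lemma units_mul1 : left_id units1 units_mul.
Proof. by move=> u; apply/val_inj/mul1r. Qed.

Lemma units_mulr1 : right_id units1 units_mul.
Proof. by move=> u; apply/val_inj/mulr1. Qed.

Lemma units_mulV : left_inverse units1 units_inv units_mul.
Proof. by move=> u; apply/val_inj/mulVf/(valP u). Qed.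

Lemma units_mulrV : right_inverse units1 units_inv units_mul.
Proof. by move=> u; apply/val_inj/mulfV/(valP u). Qed.

HB.instance Definition _ := isGroup.Build (units K)
  units_mulA units_mul1 units_mulr1 units_mulV units_mulrV.

End units_group.

(* Homomorphisms from (K, +) to the unit circle of R[i]; every one of them is
   continuous since K is discrete. *)
Record dual (R : realType) (K : zmodType) := Dual {
  dual_fun :> K -> R[i];
  dual_norm1 : forall x, `|dual_fun x| = 1;
  dual_add : forall x y, dual_fun (x + y) = dual_fun x * dual_fun y
}.

Section dual_structure.
Variables (R : realType) (K : zmodType).

HB.instance Definition _ := gen_eqMixin (dual R K).
HB.instance Definition _ := gen_choiceMixin (dual R K).

Lemma dual_eqP (xi eta : dual R K) : xi =1 eta -> xi = eta.
Proof.
case: xi eta => [f f1 fD] [g g1 gD] /= /funext fg.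
by rewrite fg in f1 fD *; congr Dual; exact: Prop_irrelevance.
Qed.

Definition dual_one : dual R K.
Proof. by exists (fun=> 1) => *; rewrite ?normr1 ?mulr1. Defined.

HB.instance Definition _ := isPointed.Build (dual R K) dual_one.

Definition dual_ptws (xi : dual R K) : {ptws K -> R[i]^o} := xi.

(* K being discrete, the compact-open topology is that of pointwise
   convergence. *)
HB.instance Definition _ := Uniform.copy (dual R K) (initial_topology dual_ptws).

HB.instance Definition _ :=
  Measurable.copy (dual R K) (g_sigma_algebraType (@open (dual R K))).

Definition dual_mul (xi eta : dual R K) : dual R K.
Proof.
exists (fun x => xi x * eta x) => [x|x y].
  by rewrite normrM !dual_norm1 mulr1.
by rewrite !dual_add mulrACA.
Defined.

End dual_structure.

Section dual_borel.
Context {R : realType}.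

Lemma cvg_dual (K : zmodType) (F : set_system (dual R K)) (xi : dual R K) :
  Filter F ->
  F --> xi <-> forall k, (fun eta : dual R K => (eta k : R[i]^o)) @ F --> (xi k : R[i]^o).
Proof.
move=> FF; split.
  move=> Fxi k; apply: cvg_trans; last first.
    apply: cvg_comp; first exact: Fxi.
    have /(_ xi) := @initial_continuous _ _ (@dual_ptws R K). 
    move=> h; apply: (cvg_comp _ _ h).
    exact: (@proj_continuous K (fun=> R[i]^o) k (dual_ptws xi)).
  exact: cvg_refl.
move=> H A /= [_ [[B oB <-] Bxi] BA].
apply: (filterS BA).
have : @dual_ptws R K @ F --> dual_ptws xi.
  apply/cvg_sup => k.
  move=> C [_ [[D oD <-] Dxi] DC].
  apply: (filterS (P := (@dual_ptws R K) @^-1` (fun f => D (f k)))) => [eta /=|].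
    exact: DC.
  apply: (H k); exact: open_nbhs_nbhs.
by apply; exact: open_nbhs_nbhs.
Qed.



Definition qC (c : rat * rat) : R[i] := (ratr c.1)%:C%C + 'i%C * (ratr c.2)%:C%C.

Definition qball (c : rat * rat) (n : nat) : set (R[i]^o) :=
  [set z | `|z - qC c| < n.+1%:R^-1 ].

Lemma qball_open c n : open (qball c n).
Proof.
rewrite openE => z /= zc.
exists (n.+1%:R^-1 - `|z - qC c|); first by rewrite /= subr_gt0.
move=> y /=; rewrite ltrBrDr => h; apply: le_lt_trans h.
rewrite -(subrK z y) -addrA (le_trans (ler_normD _ _))//.
by rewrite subrK distrC.
Qed.

Lemma rat_approx (x d : R) : 0 < d -> exists q : rat, `|x - ratr q| < d.
Proof.
move=> d0; have [|q] := @rat_in_itvoo R (x - d) (x + d); first by lra.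
by rewrite in_itv /= => /andP[? ?]; exists q; rewrite ltr_norml; lra.
Qed.

Lemma qball_base (z : R[i]^o) (V : set (R[i]^o)) : nbhs z V ->
  exists p : rat * rat * nat, qball p.1 p.2 z /\ qball p.1 p.2 `<=` V.
Proof.
move=> [e /= e0 eV].
have [r er] : exists r : R, e = r%:C%C.
  by apply/complex_realP; exact: gtr0_real.
have r0 : 0 < r by rewrite -ltcR -er.
have [n] := ltr_add_invr (y := 0) (x := r / 2) (divr_gt0 r0 (ltr0n _ 2)).
rewrite add0r => nr.
have d0 : 0 < n.+1%:R^-1 / 2 :> R by rewrite divr_gt0.
have [q1 q1P] := rat_approx (complex.Re z) d0.
have [q2 q2P] := rat_approx (complex.Im z) d0.
have nC : n.+1%:R^-1 = (n.+1%:R^-1 : R)%:C%C :> R[i].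
  by rewrite fmorphV rmorph_nat.
have zq : `|(z : R[i]) - qC (q1, q2)| < n.+1%:R^-1.
  rewrite /qC /= nC.
  have -> : (z : R[i]) - ((ratr q1)%:C%C + 'i%C * (ratr q2)%:C%C) =
    (complex.Re z - ratr q1)%:C%C + 'i%C * (complex.Im z - ratr q2)%:C%C.
    by rewrite {1}[z]complexE !rmorphB mulrBr; ring.
  rewrite (le_lt_trans (ler_normD _ _))// normrM.
  have -> : `|'i%C : R[i]| = 1 by rewrite normc_def /= expr0n expr1n add0r sqrtr1.
  have nr1 (x : R) : `|x%:C%C| = (`|x|)%:C%C :> R[i].
    by rewrite normc_def /= expr0n addr0 sqrtr_sqr.
  rewrite mul1r !nr1 -rmorphD ltcR [ltRHS]splitr; exact: ltrD.
exists (q1, q2, n); split => // y /= yq; apply: eV => /=.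
rewrite -(subrK (qC (q1, q2)) z) -addrA (le_lt_trans (ler_normD _ _))//.
rewrite [X in _ + X]distrC er (lt_trans (ltrD zq yq))// nC -rmorphD ltcR [ltRHS]splitr; exact: ltrD.
Qed.

Definition qbox (K : zmodType) (s : seq (K * ((rat * rat) * nat))) :
    set (dual R K) :=
  [set xi | forall p, p \in s -> qball p.2.1 p.2.2 (xi p.1)].

Lemma qbox_open (K : zmodType) (s : seq (K * ((rat * rat) * nat))) :
  open (qbox s).
Proof.
elim: s => [|p s IH].
  by rewrite (_ : qbox [::] = setT); [exact: openT|rewrite -subTset].
rewrite (_ : qbox _ = [set xi : dual R K | qball p.2.1 p.2.2 (xi p.1)] `&` qbox s).
  apply: openI => //.
  apply: (@open_comp _ (R[i]^o) (fun xi : dual R K => xi p.1)).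
    by move=> xi _; have /cvg_dual : nbhs xi --> xi by []; exact.
  exact: qball_open.
rewrite eqEsubset; split => [xi h|xi [h1 h2] q].
  by split; [apply: h; rewrite mem_head|move=> q qs; apply: h; rewrite inE qs orbT].
by rewrite inE => /orP[/eqP -> //|]; exact: h2.
Qed.

Lemma qbox_base (K : zmodType) (xi : dual R K) (V : set (dual R K)) :
  nbhs xi V -> exists s, qbox s xi /\ qbox s `<=` V.
Proof.
pose F : set_system (dual R K) := filter_from [set s | qbox s xi] (@qbox K).
have FF : Filter F.
  apply: filter_from_filter; first by exists [::].
  move=> s t sx tx; exists (s ++ t).
    by move=> p; rewrite mem_cat => /orP[]; [exact: sx|exact: tx].
  by move=> eta h; split => p ps; apply: h; rewrite mem_cat ps ?orbT.
have : F --> xi.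
  apply/cvg_dual => k W /qball_base[[c n] /= [cx cW]].
  exists [:: (k, (c, n))]; first by move=> p; rewrite inE => /eqP ->.
  by move=> eta h; apply: cW; exact: (h (k, (c, n)) (mem_head _ _)).
by move=> h /h [s]; exists s.
Qed.

Lemma countable_seq (T : choiceType) (S : countType) :
  countable [set: T] -> countable [set: seq (T * S)].
Proof.
move=> /countable_injP[f fi].
have finj : injective f by move=> x y; apply: fi; rewrite in_setT.
apply/countable_injP.
exists (fun s : seq (T * S) => choice.pickle (map (fun p => (f p.1, p.2)) s)).
move=> s t _ _ /(pcan_inj choice.pickleK).
apply: inj_map => -[x a] [y b] /= [/finj -> ->//].
Qed.

(* The product sigma-algebra, on which couplings live below, is the Borel
   sigma-algebra of the product space. *)
Lemma measurable_dual_prod (K L : zmodType) :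
  countable [set: K] -> countable [set: L] ->
  @measurable _ (dual R K * dual R L)%type = <<s open >>.
Proof.
move=> cK cL; rewrite eqEsubset; split; last first.
  apply: smallest_sub; first exact: sigma_algebra_measurable.
  move=> O oO.
  pose I : Type := (seq (K * ((rat * rat) * nat)) * seq (L * ((rat * rat) * nat)))%type.
  pose B (i : I) : set (dual R K * dual R L) := qbox i.1 `*` qbox i.2.
  rewrite (_ : O = \bigcup_(i : I) if `[< B i `<=` O >] then B i else set0).
    apply: countable_bigcupT_measurable.
      by rewrite -setXTT; apply: countableX; exact: countable_seq.
    move=> i; case: ifP => // _; apply: measurableX;
      apply: sub_sigma_algebra; exact: qbox_open.
  rewrite eqEsubset; split => [[x y] Oxy|p [i _]]; last first.
    by case: asboolP => // BO; exact: BO.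
  have : nbhs (x, y) O by exact: open_nbhs_nbhs.
  move=> [[P Q] /= [/qbox_base[s [sx sP]] /qbox_base[t [ty tQ]]] PQ].
  exists (s, t) => //; rewrite asboolT; first by split.
  by move=> [u v] [/= us vt]; apply: PQ; split => /=; [exact: sP|exact: tQ].
pose T : measurableType _ := g_sigma_algebraType (@open (dual R K * dual R L)%type).
have mfst : measurable_fun setT (fst : T -> dual R K).
  apply: (measurability (@open (dual R K))) => // _ [A oA <-].
  rewrite setTI; apply: sub_sigma_algebra.
  by apply: open_comp => // p _; exact: cvg_fst.
have msnd : measurable_fun setT (snd : T -> dual R L).
  apply: (measurability (@open (dual R L))) => // _ [A oA <-].
  rewrite setTI; apply: sub_sigma_algebra.
  by apply: open_comp => // p _; exact: cvg_snd.
rewrite measurable_prod_measurableType.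
apply: smallest_sub; first exact: smallest_sigma_algebra.
move=> _ [A mA] [B mB <-].
have -> : A `*` B = (fst @^-1` A) `&` (snd @^-1` B) by [].
apply: (@measurableI _ T).
  by rewrite -[X in measurable X]setTI; exact: mfst.
by rewrite -[X in measurable X]setTI; exact: msnd.
Qed.

End dual_borel.

Definition dual_map (R : realType) (K L : zmodType) (kappa : {additive K -> L})
  (eta : dual R L) : dual R K.
Proof.
exists (fun x => eta (kappa x)) => [x|x y]; first exact: dual_norm1.
by rewrite raddfD dual_add.
Defined.

(* a^*, where (a^* xi) b = xi (a * b) *)
Definition dual_scale (R : realType) (K : fieldType) (a : units K) :
    dual R K -> dual R K :=
  dual_map (val a \*o @idfun K).

(* Translation invariance determines the Haar probability measure; Borel
   probability measures on this compact metrizable group are all regular. *)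
Definition is_haar (R : realType) (K : zmodType) (m : probability (dual R K) R) :
    Prop :=
  forall (xi : dual R K) (A : set (dual R K)), measurable A ->
    m (dual_mul xi @^-1` A) = m A.

Section invariance.
Context {d : measure_display} {X : measurableType d} {R : realType} {G : Type}.
Variables (act : G -> X -> X) (nu : probability X R).

Definition invariant_measure : Prop :=
  forall (a : G) (A : set X), measurable A -> nu (act a @^-1` A) = nu A.

Definition ergodic_measure : Prop :=
  invariant_measure /\
  forall A : set X, measurable A -> (forall a, act a @^-1` A = A) ->
    nu A = 0%E \/ nu A = 1%E.

End invariance.

Section couplings.
Variables (R : realType) (K L : fieldType).
Variables (mK : probability (dual R K) R) (mL : probability (dual R L) R).
Variable rho : units K -> units L.

Definition diag_act (a : units K) (p : dual R K * dual R L) :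
    dual R K * dual R L :=
  (dual_scale a p.1, dual_scale (rho a) p.2).

Definition is_coupling (nu : probability (dual R K * dual R L)%type R) : Prop :=
  (forall A : set (dual R K), measurable A -> pushforward nu fst A = mK A) /\
  (forall B : set (dual R L), measurable B -> pushforward nu snd B = mL B).

Definition trivial_coupling (nu : probability (dual R K * dual R L)%type R) :
    Prop :=
  forall A : set (dual R K * dual R L), measurable A -> nu A = (mK \x mL)%E A.

Definition disjoint_actions : Prop :=
  forall nu : probability (dual R K * dual R L)%type R,
    is_coupling nu -> invariant_measure diag_act nu -> trivial_coupling nu.

End couplings.

(* The map x |-> w(x) rho(x) for x != 0, extended by 0 |-> 0. *)
Definition twist (K L : fieldType) (w rho : units K -> units L) (x : K) : L :=
  if insub x is Some u then val (w u) * val (rho u) else 0.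

(* Main.v *)
Require Import Defs.
From HB Require Import structures.
From mathcomp Require Import all_boot all_order all_algebra finmap.
From mathcomp Require Import all_classical all_reals all_analysis.
From mathcomp Require Import measurable_realfun.
From mathcomp.real_closed Require Import complex.
From mathcomp Require Import ring lra.

Set Implicit Arguments.
Unset Strict Implicit.
Unset Printing Implicit Defensive.

Import Order.TTheory GRing.Theory Num.Theory.
Import numFieldNormedType.Exports.

Local Open Scope classical_set_scope.
Local Open Scope ring_scope.

(** Let [nu] be a nontrivial invariant coupling, and extend [rho] to a map [r] by
    [r 0 = 0]. By invariance the Fourier coefficient of [nu] at [(x, y)], for
    nonzero [x] and [y], depends only on [y / r x]; it vanishes if exactly one of
    [x] and [y] is zero, because the marginals are Haar measures. Since Fourier
    coefficients determine a measure ([fourier_unique]), some coefficient at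
    some [(1, y1)] is nonzero ([nontrivial_coupling]). All the characters at the
    points [(a, r a * y1)] then have the same nonzero integral, so
    Cauchy-Schwarz forces two of them to be correlated as soon as there are
    enough of them; as only finitely many coefficients at the points [(1, y)]
    are large, by Bessel's inequality, this means that any long enough list of
    scalars contains [a] and [b] with [(r a - r b) / r (a - b)] in a fixed finite
    set ([coupling_slopes]).

    This property alone makes [r] a field isomorphism up to finitely many factors
    ([almost_additive_isomorphism]). For [b] generic along a nonprincipal
    ultrafilter on [K], it yields [r (v + b) = s v * (k v + r b)] with [s v] in a
    finite set. Comparing two values of [v] shows that [k v - k v'] is a bounded
    multiple of [r (v - v')]. The increments of [k] being controlled in this way
    from both summands, [k] is additive; two additive maps with finitely many
    ratios are proportional, so [k / k 1] is multiplicative; and it is onto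
    because finitely many lines over an infinite subfield cannot cover [L].

    Once [kappa] and [w] are known, regard [K * L] as a vector space over [K]
    through [kappa]. The kernel of [w], of finite index, acts on it by scalars,
    and the coefficient of an invariant coupling at [v] is the measure of the set
    where the character is trivial on the whole line spanned by [v]
    ([coef_line_set]). Indeed, outside this set the real parts of the
    coefficients on the line are nonnegative, by positive definiteness along
    scalars with all their differences in one coset of the kernel, while
    suitable averages of them over the line tend to zero. For [v = (1, y)] these
    sets are graphs over the dual of [L], disjoint up to a null set, and the
    action multiplies [y] by elements of the image of [w]. Ergodicity therefore
    puts the whole mass, equally distributed, on the graphs of one coset of that
    image ([ergodic_graphs]), and the coupling has the same Fourier coefficients
    as a translate of the average [mu] of the graph measures
    ([ergodic_coupling_form]). *)

(** * Ultrafilters *)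

Section ultrafilters.

Lemma ultra_finite_range (T : Type) (V : eqType) (U : set_system T)
    (UU : UltraFilter U) (f : T -> V) (s : seq V) :
  (\forall a \near U, f a \in s) ->
  exists2 v, v \in s & \forall a \near U, f a = v.
Proof.
elim: s => [|v s IH] Us.
  by have /filter_ex[a] : \forall a \near U, f a \in [::] by exact: Us.
have [Uv|Uv] := in_ultra_setVsetC [set a | f a = v] UU.
  by exists v => //; rewrite mem_head.
have [|v' v's Uv'] := IH; last by exists v' => //; rewrite inE v's orbT.
near=> a; have : f a \in v :: s by near: a.
by rewrite inE => /orP[/eqP fav|//]; suff : ~ f a = v by []; near: a.
Unshelve. all: by end_near. Qed.

Lemma nonprincipal_ultra (T : Type) : infinite_set [set: T] ->
  exists2 U : set_system T, UltraFilter U & @frechet_filter T `<=` U.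
Proof.
by move=> /frechet_properfilter /ultraFilterLemma[U [? ?]]; exists U.
Qed.

Variables (T : eqType) (U : set_system T) (UU : UltraFilter U).
Hypothesis U_cof : @frechet_filter T `<=` U.

Lemma ultra_neq (a : T) : \forall b \near U, b != a.
Proof.
apply: U_cof; rewrite /frechet_filter /=.
rewrite (_ : ~` _ = [set a]) // eqEsubset; split => b /=.
  by move/negP; rewrite negbK => /eqP.
by move=> -> ; rewrite eqxx.
Qed.

(** Each new term of the list is chosen generic with respect to the finitely
    many previous ones; this plays the part of Ramsey's theorem. *)
Lemma ultra_pairwise (A : pred T) (q : rel T) (n : nat) :
  (\forall a \near U, A a) ->
  (\forall a \near U, \forall b \near U, q a b) ->
  exists s, [/\ size s = n, uniq s, all A s & pairwise q s].
Proof.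
move=> UA Uq.
suff [s [ss us As qs _]] : exists s, [/\ size s = n, uniq s, all A s,
    pairwise q s & forall a, a \in s -> \forall b \near U, q a b].
  by exists s.
elim: n => [|n [s [ss us As qs qU]]]; first by exists [::].
have Hs (t : seq T) : {subset t <= s} ->
    \forall b \near U, (b \notin t) && all (q^~ b) t.
  elim: t => [|a t IH] ts; first exact: nearW.
  have ta : {subset t <= s} by move=> x xt; apply: ts; rewrite inE xt orbT.
  have qa := qU a (ts _ (mem_head _ _)).
  near=> b; rewrite inE negb_or /=.
  have -> /= : b != a by near: b; exact: ultra_neq.
  have -> /= : q a b by near: b.
  by near: b; exact: IH.
have /filter_ex[b [Ab [qb /andP[bs sb]]]] : \forall b \near U,
    A b /\ (\forall c \near U, q b c) /\ (b \notin s) && all (q^~ b) s.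
  near=> b; split; first by near: b.
  by split; near: b => //; exact: Hs.
exists (rcons s b); split.
- by rewrite size_rcons ss.
- by rewrite rcons_uniq bs.
- by rewrite all_rcons Ab.
- by rewrite pairwise_rcons sb.
- by move=> a; rewrite mem_rcons inE => /orP[/eqP ->//|/qU].
Unshelve. all: by end_near. Qed.

End ultrafilters.

(** * Almost additive multiplicative maps between fields *)

Section almost_additive.
Variables (K L : fieldType) (r : K -> L).
Hypotheses (r0 : r 0 = 0) (r1 : r 1 = 1) (rM : {morph r : x y / x * y}).
Hypotheses (r_inj : injective r) (r_surj : forall y, exists x, r x = y).

Let r_eq0 x : (r x == 0) = (x == 0).
Proof. by rewrite -(inj_eq r_inj) r0. Qed.

Let rV x : r x^-1 = (r x)^-1.
Proof.
have [->|x0] := eqVneq x 0; first by rewrite invr0 r0 invr0.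
have rx0 : r x != 0 by rewrite r_eq0.
by apply: (mulfI rx0); rewrite -rM !divff.
Qed.

Variables (U : set_system K) (UU : UltraFilter U).
Hypothesis U_cof : @frechet_filter K `<=` U.

Lemma ultra_avoid (V : eqType) (f : K -> V) (s : seq V) : injective f ->
  \forall a \near U, f a \notin s.
Proof.
move=> fI; elim: s => [|v s IH]; first exact: nearW.
have Uv : \forall a \near U, f a != v.
  have [[a0 <-]|nv] := pselect (exists a0, f a0 = v).
    by near=> a; rewrite (inj_eq fI); near: a; exact: ultra_neq.
  by apply: nearW => a; apply/eqP => fav; apply: nv; exists a.
by near=> a; rewrite inE negb_or; apply/andP; split; near: a.
Unshelve. all: by end_near. Qed.

(** [r] takes infinitely many values on generic elements, whereas a nonzero
    affine function has at most one zero. *)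
Lemma affine_generic_eq0 (al be : L) :
  (\forall b \near U, al + be * r b = 0) -> al = 0 /\ be = 0.
Proof.
move=> Uab.
have /filter_ex[a ea] := Uab.
have /filter_ex[b [eb ba]] : \forall b \near U, al + be * r b = 0 /\ b != a.
  by near=> b; split; near: b => //; exact: ultra_neq.
have : be * (r a - r b) = 0.
  by rewrite mulrBr -[be * r a](addKr al) ea -[be * r b](addKr al) eb subrr.
move/eqP; rewrite mulf_eq0 subr_eq0 (inj_eq r_inj) [a == b]eq_sym (negbTE ba).
rewrite orbF => /eqP be0; split => //.
by move: ea; rewrite be0 mul0r addr0.
Unshelve. all: by end_near. Qed.

Section slopes.
Variables (S : seq L) (N : nat).
Hypothesis S_hit : forall s : seq K, uniq s -> all (fun a : K => a != 0) s ->
  size s = N ->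
  ~~ pairwise (fun a b => r a - r b \notin [seq t * r (a - b) | t <- S]) s.

(** If the slopes of [r] between generic points avoided [S], they would do so
    along a list of length [N]. Hence they generically lie in the finite set
    [S], and one of its elements is generic. *)
Lemma generic_slope (g : K -> K) : injective g ->
  exists2 t, t \in S & \forall a \near U, \forall b \near U,
    r (g a) - r (g b) = t * r (g a - g b).
Proof.
move=> gI.
pose q a b := r (g a) - r (g b) \in [seq t * r (g a - g b) | t <- S].
have [Uq|Uq] := in_ultra_setVsetC [set a | \forall b \near U, q a b] UU.
  have /choice[tt ttP] : forall a, exists t : L, (\forall b \near U, q a b) ->
      t \in S /\ \forall b \near U, r (g a) - r (g b) = t * r (g a - g b).
    move=> a; have [Ua|?] := pselect (\forall b \near U, q a b); last first.
      by exists 0.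
    have /choice[t tP] : forall b, exists t, q a b ->
        t \in S /\ r (g a) - r (g b) = t * r (g a - g b).
      move=> b; have [|] := boolP (q a b); last by exists 0.
      by move=> /mapP[t tS e]; exists t.
    have [|t0 t0S Ut] := @ultra_finite_range K L U UU t S.
      by apply: filterS Ua => b /tP[].
    exists t0 => _; split=> //; near=> b.
    have -> : t0 = t b by apply/esym; near: b.
    by apply: (tP b _).2; near: b.
  have [|t tS Ut] := @ultra_finite_range K L U UU tt S.
    by apply: filterS Uq => a /ttP[].
  exists t => //; near=> a.
  have -> : t = tt a by apply/esym; near: a.
  by apply: (ttP a _).2; near: a.
have Uq' : \forall a \near U, \forall b \near U, ~~ q a b.
  apply: filterS Uq => a /= Ua.
  have [//|Ua'] := in_ultra_setVsetC [set b | q a b] UU.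
  by apply: filterS Ua' => b /= /negP.
have U0 : \forall a \near U, g a != 0.
  by near=> a; have : g a \notin [:: 0]; [near: a; exact: ultra_avoid|rewrite inE].
have [s [ss us s0 sq]] := ultra_pairwise UU U_cof N U0 Uq'.
have gus : uniq (map g s) by rewrite map_inj_uniq.
have gs0 : all (fun a : K => a != 0) (map g s) by rewrite all_map.
have /negP := S_hit gus gs0 (etrans (size_map g s) ss).
by rewrite pairwise_map => /(_ sq).
Unshelve. all: by end_near. Qed.

(** Translation by a fixed [v] acts on generic values as an affine map. Its
    slope [sk.1] varies irregularly with [v], but its zero [- sk.2] will turn
    out to be additive in [v]. *)
Lemma generic_translate v : exists2 sk : L * L, sk.1 != 0 /\
    sk.1 \in [seq t / t' | t <- S, t' <- S] &
    \forall b \near U, r (v + b) = sk.1 * (sk.2 + r b).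
Proof.
have [t tS Ut] := @generic_slope (fun a => v + a) (addrI v).
have [t' t'S Ut'] := @generic_slope id (@inj_id K).
have /filter_ex[a [Ha Ha']] : \forall a \near U,
    (\forall b \near U, r (v + a) - r (v + b) = t * r (v + a - (v + b))) /\
    \forall b \near U, r a - r b = t' * r (a - b).
  by near=> a; split; near: a.
have /filter_ex[b [[Hb Hb'] ba]] : \forall b \near U,
    (r (v + a) - r (v + b) = t * r (v + a - (v + b)) /\
    r a - r b = t' * r (a - b)) /\ b != a.
  by near=> b; split; [split; near: b|near: b; exact: ultra_neq].
have t0 : t != 0.
  apply/eqP => t0; move: Hb; rewrite t0 mul0r => /eqP.
  by rewrite subr_eq0 (inj_eq r_inj) (inj_eq (addrI v)) eq_sym (negbTE ba).
have t'0 : t' != 0.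
  apply/eqP => t0'; move: Hb'; rewrite t0' mul0r => /eqP.
  by rewrite subr_eq0 (inj_eq r_inj) eq_sym (negbTE ba).
exists (t / t', (t' / t) * r (v + a) - r a) => /=.
  split; first by rewrite mulf_neq0 // invr_eq0.
  by apply/allpairsP; exists (t, t').
near=> c.
have e1 : r (v + a) - r (v + c) = t * r (v + a - (v + c)) by near: c.
have e2 : r a - r c = t' * r (a - c) by near: c.
have e3 : v + a - (v + c) = a - c by ring.
rewrite e3 in e1.
have -> : r (v + c) = r (v + a) - t * r (a - c) by rewrite -e1 subKr.
have -> : r (a - c) = (r a - r c) / t' by rewrite e2 mulrAC divff ?mul1r.
by field; rewrite t0.
Unshelve. all: by end_near. Qed.

(** The quotient of the translates [v + b] and [v' + b] is affine in the generic
    element [(v' + b)^-1]. Computing the slope of [r] along it in two ways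
    expresses [k - k'] as a bounded multiple of [r (v - v')]. *)
Lemma generic_translate_diff (v v' : K) (s s' k k' : L) :
  v != v' -> s != 0 -> s' != 0 ->
  (\forall b \near U, r (v + b) = s * (k + r b)) ->
  (\forall b \near U, r (v' + b) = s' * (k' + r b)) ->
  exists t t', [/\ t \in S, t' \in S, t != 0, t' != 0 &
    k - k' = t / (t' * s) * r (v - v')].
Proof.
move=> vv' s0 s'0 Uk Uk'; set d := v - v'.
have d0 : d != 0 by rewrite subr_eq0.
pose Z b := (v' + b)^-1.
have ZI : injective Z by move=> a b /invr_inj /addrI.
have dZI : injective (fun b => 1 + d * Z b).
  by move=> a b /addrI /(mulfI d0) /ZI.
have [t tS Ut] := generic_slope dZI; have [t' t'S Ut'] := generic_slope ZI.
have Hd : \forall b \near U,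
    r (1 + d * Z b) = s * (k - k') * r (Z b) + s / s'.
  near=> b.
  have b0 : v' + b != 0.
    rewrite addrC addr_eq0; near: b; exact: ultra_neq.
  have e : 1 + d * Z b = (v + b) / (v' + b) by rewrite /Z /d; field.
  have rb0 : r (v' + b) != 0 by rewrite r_eq0.
  have e1 : r (v + b) = s * (k + r b) by near: b.
  have e2 : r (v' + b) = s' * (k' + r b) by near: b.
  rewrite e rM e1 /Z !rV.
  have -> : r b = r (v' + b) / s' - k' by rewrite e2 mulrC mulKf // addrC addKr.
  by field; rewrite s'0 rb0.
have /filter_ex[a [[Ha Ha'] Hda]] : \forall a \near U, ((\forall b \near U,
    r (1 + d * Z a) - r (1 + d * Z b) = t * r (1 + d * Z a - (1 + d * Z b))) /\
    \forall b \near U, r (Z a) - r (Z b) = t' * r (Z a - Z b)) /\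
    r (1 + d * Z a) = s * (k - k') * r (Z a) + s / s'.
  by near=> a; split; [split|]; near: a.
have /filter_ex[b [[Hb Hb'] [Hdb ba]]] : \forall b \near U,
   (r (1 + d * Z a) - r (1 + d * Z b) = t * r (1 + d * Z a - (1 + d * Z b)) /\
    r (Z a) - r (Z b) = t' * r (Z a - Z b)) /\
    (r (1 + d * Z b) = s * (k - k') * r (Z b) + s / s' /\ b != a).
  by near=> b; split; split; near: b => //; exact: ultra_neq.
have t0 : t != 0.
  apply/eqP => t0; move: Hb; rewrite t0 mul0r => /eqP.
  by rewrite subr_eq0 (inj_eq r_inj) (inj_eq dZI) eq_sym (negbTE ba).
have t'0 : t' != 0.
  apply/eqP => t0'; move: Hb'; rewrite t0' mul0r => /eqP.
  by rewrite subr_eq0 (inj_eq r_inj) (inj_eq ZI) eq_sym (negbTE ba).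
exists t, t'; split => //.
have rZ0 : r (Z a - Z b) != 0.
  by rewrite r_eq0 subr_eq0 (inj_eq ZI) eq_sym.
have e : 1 + d * Z a - (1 + d * Z b) = d * (Z a - Z b) by ring.
have : s * (k - k') * t' * r (Z a - Z b) = t * r d * r (Z a - Z b).
  by rewrite -!mulrA -rM -e -Hb Hda Hdb -Hb'; ring.
move=> /(mulIf rZ0) E.
have -> : k - k' = s * (k - k') * t' / (t' * s) by field; rewrite s0 t'0.
by rewrite E; field; rewrite ?t'0 ?s0.
Unshelve. all: by end_near. Qed.

(** [- k v] is the zero of the affine map by which [v] translates generic
    values. *)
Lemma exists_almost_additive : exists (k : K -> L) (M : seq L),
  [/\ k 0 = 0, injective k &
   forall v v', exists2 t, t \in M & k v - k v' = t * r (v - v')].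
Proof.
have /choice[sk skP] : forall v, exists sk : L * L, [/\ sk.1 != 0,
    sk.1 \in [seq t / t' | t <- S, t' <- S] &
    \forall b \near U, r (v + b) = sk.1 * (sk.2 + r b)].
  by move=> v; have [sk [? ?] ?] := generic_translate v; exists sk.
pose S2 := [seq t / t' | t <- S, t' <- S].
exists (fun v => (sk v).2),
  (0 :: [seq t / p | t <- S, p <- [seq t' * s | t' <- S, s <- S2]]).
have diff v v' : v != v' -> exists t t', [/\ t \in S, t' \in S, t != 0, t' != 0
    & (sk v).2 - (sk v').2 = t / (t' * (sk v).1) * r (v - v')].
  move=> vv'; have [s0 _ Us] := skP v; have [s'0 _ Us'] := skP v'.
  by have := generic_translate_diff vv' s0 s'0 Us Us'.
split.
- have [s0 _ U0] := skP 0; set s := (sk 0).1 in s0 U0 *; set k := (sk 0).2 in U0 *.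
  have [|sk0 _] := @affine_generic_eq0 (s * k) (s - 1).
    near=> b; have : r (0 + b) = s * (k + r b) by near: b.
    by rewrite add0r => e; rewrite mulrBl addrA -mulrDr -e mul1r subrr.
  by move/eqP: sk0; rewrite mulf_eq0 (negbTE s0) => /eqP.
- move=> v v' e; apply: contrapT => /eqP /[dup] /diff[t [t' [_ _ t0 t'0]]].
  rewrite e subrr => /esym/eqP; have [s0 _ _] := skP v.
  by rewrite !mulf_eq0 invr_eq0 mulf_eq0 r_eq0 subr_eq0 (negbTE t0) (negbTE t'0)
    (negbTE s0) => /= ->.
- move=> v v'; have [->|] := eqVneq v v'.
    by exists 0; rewrite ?mem_head // !subrr r0 mul0r.
  move=> /diff[t [t' [tS t'S _ _ E]]]; have [_ sS _] := skP v.
  exists (t / (t' * (sk v).1)) => //; rewrite inE; apply/orP; right.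
  apply/allpairsP; exists (t, t' * (sk v).1); split=> //=.
  by apply/allpairsP; exists (t', (sk v).1).
Unshelve. all: by end_near. Qed.

End slopes.

Section additivity.
Variables (k : K -> L) (M : seq L).
Hypotheses (k0 : k 0 = 0) (k_inj : injective k).
Hypothesis kM : forall v v', exists2 t, t \in M & k v - k v' = t * r (v - v').

Let k_eq0 x : (k x == 0) = (x == 0).
Proof. by rewrite -(inj_eq k_inj) k0. Qed.

Let kMr v : exists2 t, t \in M & k v = t * r v.
Proof. by have := kM v 0; rewrite k0 !subr0. Qed.

(** The increment of [k] from [v] to [v + d] is a bounded multiple of [r d],
    that from [d] to [v + d] one of [r v]: for generic [v] this forces both to
    be the values of [k]. *)
Lemma almost_additiveD_generic (f : K -> K) (d : K) : injective f ->
  \forall z \near U, k (f z + d) = k (f z) + k d.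
Proof.
move=> fI.
pose Q := [seq p / q * r d | p <- [seq a - b | a <- M, b <- M],
                             q <- [seq a - b | a <- M, b <- M]].
near=> z; set v := f z.
have rv : r v \notin Q.
  by rewrite /v; near: z; apply: (@ultra_avoid _ (r \o f)) => a b /r_inj /fI.
have [t1 t1M] := kM (v + d) v; rewrite addrAC subrr add0r => e1.
have [t2 t2M] := kM (v + d) d; rewrite addrK => e2.
have [t3 t3M e3] := kMr v; have [t4 t4M e4] := kMr d.
have [t32|t32] := eqVneq t3 t2.
  by rewrite -(subrK (k d) (k (v + d))) e2 -t32 -e3.
case/negP: rv; apply/allpairsP; exists (t4 - t1, t3 - t2); split=> /=.
- by apply/allpairsP; exists (t4, t1).
- by apply/allpairsP; exists (t3, t2).
have E : (t3 - t2) * r v = (t4 - t1) * r d.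
  by rewrite !mulrBl -e1 -e2 -e3 -e4; ring.
by rewrite mulrAC -E mulrAC divff ?mul1r // subr_eq0.
Unshelve. all: by end_near. Qed.

(** Associativity of the sum of [v], [d] and a generic [z]. *)
Lemma almost_additiveD : {morph k : x y / x + y}.
Proof.
move=> v d.
have /filter_ex[z [e1 [e2 e3]]] : \forall z \near U,
    k (z + (v + d)) = k z + k (v + d) /\
    (k ((z + v) + d) = k (z + v) + k d /\ k (z + v) = k z + k v).
  near=> z; split; last split; near: z.
  - exact: (@almost_additiveD_generic id).
  - exact: (@almost_additiveD_generic (+%R^~ v) d (addIr v)).
  - exact: (@almost_additiveD_generic id).
by apply: (@addrI _ (k z)); rewrite -e1 addrA e2 e3 addrA.
Unshelve. all: by end_near. Qed.

(** The additive maps [fun v => k (u * v)] and [k] have ratio in a finite set.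
    Where the ratios at [v], [d] and [v + d] are not all equal, [k v] is a
    bounded multiple of [k d]; so the ratio at [d] is the generic one. *)
Lemma almost_additive_scale u : exists c, forall v, k (u * v) = c * k v.
Proof.
pose Q := [seq p / q | p <- [seq t * r u | t <- M], q <- M].
have ratio v : exists2 c, c \in Q & k (u * v) = c * k v.
  have [t tM e] := kMr (u * v).
  have [v0|v0] := eqVneq v 0.
    have [t' t'M _] := kMr v.
    exists (t * r u / t'); last by rewrite v0 mulr0 k0 mulr0.
    by apply/allpairsP; exists (t * r u, t'); split => //; exact: map_f.
  have [t' t'M e'] := kMr v.
  have t'0 : t' != 0.
    by apply/eqP => t'0; move/eqP: e'; rewrite t'0 mul0r k_eq0 (negbTE v0).
  exists (t * r u / t').
    by apply/allpairsP; exists (t * r u, t'); split => //; exact: map_f.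
  by rewrite e e' rM; field.
have /choice[cc ccP] : forall v, exists c, c \in Q /\ k (u * v) = c * k v.
  by move=> v; have [c ? ?] := ratio v; exists c.
have [|c cQ Uc] := @ultra_finite_range K L U UU cc Q.
  by apply: nearW => v; have [] := ccP v.
exists c => d; have [_ ed] := ccP d; set c2 := cc d in ed.
pose B := [seq (c2 - c1) / (c1 - c) * k d | c1 <- Q].
have /filter_ex[v [vc vB]] : \forall v \near U, cc v = c /\ k v \notin B.
  by near=> v; split; near: v => //; exact: ultra_avoid.
have [_ ev] := ccP v; rewrite vc in ev.
have [c1Q evd] := ccP (v + d); set c1 := cc (v + d) in c1Q evd.
have E : (c1 - c) * k v = (c2 - c1) * k d.
  by move: evd; rewrite mulrDr !almost_additiveD ev ed !mulrBl mulrDr; move/(congr1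
    (fun x => c1 * k v + c1 * k d - x)); rewrite subrr => H; apply/eqP;
    rewrite -subr_eq0 -[X in _ == X]H; apply/eqP; ring.
have [c1c|c1c] := eqVneq c1 c.
  by rewrite ed; move/eqP: E; rewrite c1c subrr mul0r eq_sym mulrBl subr_eq0 => /eqP.
case/negP: vB; apply/mapP; exists c1 => //.
by rewrite mulrAC -E mulrAC divff ?mul1r // subr_eq0.
Unshelve. all: by end_near. Qed.

Let k1_neq0 : k 1 != 0.
Proof. by rewrite k_eq0 oner_neq0. Qed.

Lemma almost_additiveM x y : k (x * y) / k 1 = (k x / k 1) * (k y / k 1).
Proof.
have [c cP] := almost_additive_scale x.
have := cP 1; rewrite mulr1 => cx.
by rewrite cP cx; field.
Qed.

(** Finitely many lines over the infinite field [k K / k 1] cannot cover a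
    larger field: some line would contain two translates of [y] by that
    field. *)
Lemma almost_additive_surj y : exists x, k x / k 1 = y.
Proof.
pose ka x := k x / k 1.
have kaD x x' : ka (x + x') = ka x + ka x' by rewrite /ka almost_additiveD mulrDl.
have kaN x : ka (- x) = - ka x.
  by apply: (@addrI _ (ka x)); rewrite -kaD !subrr /ka k0 mul0r.
have kaB x x' : ka (x - x') = ka x - ka x' by rewrite kaD kaN.
have ka_eq0 x : (ka x == 0) = (x == 0).
  by rewrite /ka mulf_eq0 invr_eq0 k_eq0 (negbTE k1_neq0) orbF.
have kaV x : ka x^-1 = (ka x)^-1.
  have [->|x0] := eqVneq x 0; first by rewrite invr0 /ka k0 mul0r invr0.
  have x0' : ka x != 0 by rewrite ka_eq0.
  apply: (mulfI x0'); rewrite /ka -almost_additiveM divff // -/(ka x).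
  by rewrite !divff.
have /choice[x xP] : forall a, exists x, r x = y + ka a by move=> a.
have /choice[mm mP] : forall a, exists m, m \in M /\ ka (x a) = m / k 1 * r (x a).
  by move=> a; have [m mM e] := kMr (x a); exists m; rewrite /ka e; split=> //; ring.
have [|m mM Um] := @ultra_finite_range K L U UU mm M.
  by apply: nearW => a; have [] := mP a.
have /filter_ex[a ea] := Um.
have /filter_ex[b [eb ba]] : \forall b \near U, mm b = m /\ b != a.
  by near=> b; split; near: b => //; exact: ultra_neq.
have [_ ea'] := mP a; rewrite ea xP in ea'.
have [_ eb'] := mP b; rewrite eb xP in eb'.
exists (x a / (x a - x b) * (a - b) - a); rewrite -/(ka _) kaB.
rewrite {1}/ka almost_additiveM almost_additiveM -/(ka _) -/(ka (_^-1)) -/(ka (a - b)).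
rewrite kaV !kaB ea' eb'.
have ab0 : ka a - ka b != 0 by rewrite -kaB ka_eq0 subr_eq0 eq_sym.
have [m0|m0] := eqVneq m 0.
  move/eqP: (ea'); rewrite m0 !mul0r ka_eq0 => /eqP xa0.
  by move/eqP: (xP a); rewrite xa0 r0 eq_sym addr_eq0 => /eqP ->; ring.
field; rewrite k1_neq0 /=.
rewrite [X in X != 0](_ : _ = m * (ka a - ka b)); last by ring.
by rewrite mulf_neq0.
Unshelve. all: by end_near. Qed.

End additivity.

End almost_additive.

(** The typical such [r] is the quotient of an isomorphism by a homomorphism
    with finite image, and there are no others: the isomorphism is [k / k 1]
    for the map [k] of [exists_almost_additive]. *)
Theorem almost_additive_isomorphism (K L : fieldType) (r : K -> L)
    (S : seq L) (N : nat) :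
  infinite_set [set: K] ->
  r 0 = 0 -> r 1 = 1 -> {morph r : x y / x * y} -> injective r ->
  (forall y, exists x, r x = y) ->
  (forall s : seq K, uniq s -> all (fun a : K => a != 0) s -> size s = N ->
    ~~ pairwise (fun a b => r a - r b \notin [seq t * r (a - b) | t <- S]) s) ->
  exists (kappa : {rmorphism K -> L}) (M : seq L), bijective kappa /\
    forall x, x != 0 -> exists2 t, t \in M & kappa x = t * r x.
Proof.
move=> infK r0 r1 rM r_inj r_surj S_hit.
have [U UU U_cof] := nonprincipal_ultra infK.
have [k [M [k0 k_inj kM]]] :=
  exists_almost_additive r0 r1 rM r_inj UU U_cof S_hit.
have kD := almost_additiveD r_inj UU U_cof k0 kM.
have kM1 := almost_additiveM rM r_inj UU U_cof k0 k_inj kM.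
have ks := almost_additive_surj r0 rM r_inj r_surj UU U_cof k0 k_inj kM.
have k1 : k 1 != 0 by rewrite -k0 (inj_eq k_inj) oner_neq0.
pose ka x := k x / k 1.
have kaD : {morph ka : x y / x + y} by move=> x y; rewrite /ka kD mulrDl.
have kaB : zmod_morphism ka.
  move=> x y; apply: (@addIr _ (ka y)); rewrite -kaD !subrK //.
have kaM : monoid_morphism ka by split; [rewrite /ka divff|exact: kM1].
pose ka1 := GRing.isZmodMorphism.Build K L ka kaB.
pose ka2 := GRing.isMonoidMorphism.Build K L ka kaM.
pose kappa : {rmorphism K -> L} := HB.pack ka ka1 ka2.
exists kappa, [seq t / k 1 | t <- M]; split.
  have /choice[g gP] : forall y, exists x, kappa x = y by move=> y; exact: ks.
  by exists g => // x; apply: (fmorph_inj kappa); rewrite gP.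
move=> x x0; have [t tM e] := kM x 0.
exists (t / k 1); first exact: map_f.
by move: e; rewrite k0 !subr0 /kappa /= /ka => ->; ring.
Qed.

(** * Integrals of bounded measurable functions *)

Section bounded_measurable.
Context {d : measure_display} {X : measurableType d} {R : realType}.
Implicit Types (f g : X -> R) (m : probability X R) (E : set X).

Definition bounded_measurable f :=
  measurable_fun setT f /\ exists B, forall x, `|f x| <= B.

Lemma bm_cst (a : R) : bounded_measurable (fun=> a).
Proof. by split=> //; exists `|a|. Qed.

Lemma bmD f g : bounded_measurable f -> bounded_measurable g ->
  bounded_measurable (fun x => f x + g x).
Proof.
move=> [mf [B fB]] [mg [C gC]]; split; first exact: measurable_funD.
by exists (B + C) => x; rewrite (le_trans (ler_normD _ _)) // lerD.
Qed.

Lemma bmM f g : bounded_measurable f -> bounded_measurable g ->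
  bounded_measurable (fun x => f x * g x).
Proof.
move=> [mf [B fB]] [mg [C gC]]; split; first exact: measurable_funM.
by exists (B * C) => x; rewrite normrM ler_pM.
Qed.

Lemma bmZ a f : bounded_measurable f -> bounded_measurable (fun x => a * f x).
Proof. exact/bmM/bm_cst. Qed.

Lemma bmB f g : bounded_measurable f -> bounded_measurable g ->
  bounded_measurable (fun x => f x - g x).
Proof.
move=> bf bg; have := bmD bf (bmZ (-1) bg).
by under eq_fun do rewrite mulN1r.
Qed.

Lemma bm_sum (I : Type) (s : seq I) (h : I -> X -> R) :
  (forall i, bounded_measurable (h i)) ->
  bounded_measurable (fun x => \sum_(i <- s) h i x).
Proof.
move=> bh; elim: s => [|i s IH].
  by under eq_fun do rewrite big_nil; exact: bm_cst.
by under eq_fun do rewrite big_cons; exact: bmD.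
Qed.

Lemma bm_exp f n : bounded_measurable f ->
  bounded_measurable (fun x => f x ^+ n).
Proof.
move=> bf; elim: n => [|n IH]; first exact: bm_cst.
by under eq_fun do rewrite exprS; exact: bmM.
Qed.

Lemma bm_integrable m E f : measurable E -> bounded_measurable f ->
  m.-integrable E (EFin \o f).
Proof.
move=> mE [mf [B fB]]; apply: measurable_bounded_integrable => //.
- by rewrite (le_lt_trans (probability_le1 m mE)) // ltry.
- exact: measurable_funTS.
- exists B; split; first exact: num_real.
  by move=> C BC x _; exact: le_trans (fB x) (ltW BC).
Qed.

Lemma bm_RintegralD m E f g : measurable E ->
  bounded_measurable f -> bounded_measurable g ->
  \int[m]_(x in E) (f x + g x) = \int[m]_(x in E) f x + \int[m]_(x in E) g x.
Proof. by move=> mE bf bg; rewrite RintegralD //; exact: bm_integrable. Qed.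

Lemma bm_RintegralZ m E a f : measurable E -> bounded_measurable f ->
  \int[m]_(x in E) (a * f x) = a * \int[m]_(x in E) f x.
Proof. by move=> mE bf; rewrite RintegralZl //; exact: bm_integrable. Qed.

Lemma bm_Rintegral_sum m E (I : Type) (s : seq I) (h : I -> X -> R) :
  measurable E -> (forall i, bounded_measurable (h i)) ->
  \int[m]_(x in E) (\sum_(i <- s) h i x) =
  \sum_(i <- s) \int[m]_(x in E) h i x.
Proof.
move=> mE bh; elim: s => [|i s IH].
  rewrite big_nil; under eq_Rintegral do rewrite big_nil.
  by rewrite Rintegral_cst // mul0r.
rewrite big_cons -IH -bm_RintegralD //; last exact: bm_sum.
by apply: eq_Rintegral => x _; rewrite big_cons.
Qed.

Lemma bm_le_Rintegral m E f g : measurable E ->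
  bounded_measurable f -> bounded_measurable g ->
  (forall x, E x -> f x <= g x) ->
  \int[m]_(x in E) f x <= \int[m]_(x in E) g x.
Proof. by move=> mE bf bg fg; apply: le_Rintegral => //; exact: bm_integrable. Qed.

Lemma fine_probability_le1 m E : measurable E -> fine (m E) <= 1.
Proof.
move=> mE; rewrite -lee_fin fineK ?probability_le1 //.
exact: fin_num_measure.
Qed.

(** Expand the integral of [(f - a) ^+ 2], where [a] is the integral of [f]. *)
Lemma bm_Rintegral_sqr m E f : measurable E -> bounded_measurable f ->
  (\int[m]_(x in E) f x) ^+ 2 <= \int[m]_(x in E) (f x ^+ 2).
Proof.
move=> mE bf; set a := \int[m]_(x in E) f x.
have : 0 <= \int[m]_(x in E) ((f x - a) ^+ 2).
  by apply: Rintegral_ge0 => x _; exact: sqr_ge0.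
have -> : \int[m]_(x in E) ((f x - a) ^+ 2) =
    \int[m]_(x in E) (f x ^+ 2 + ((- (2 * a)) * f x + a ^+ 2)).
  by apply: eq_Rintegral => x _; ring.
have b1 := bmZ (- (2 * a)) bf; have b2 := bm_cst (a ^+ 2).
rewrite bm_RintegralD //; [|exact: bm_exp|exact: bmD].
rewrite (bm_RintegralD m mE b1 b2) bm_RintegralZ //.
rewrite Rintegral_cst // -/a.
have m1 := fine_probability_le1 m mE.
have : a ^+ 2 * fine (m E) <= a ^+ 2 by rewrite ler_piMr // sqr_ge0.
nra.
Qed.

Lemma bm_dominated m E (f_ : nat -> X -> R) f (B : R) : measurable E ->
  (forall n, measurable_fun setT (f_ n)) -> measurable_fun setT f ->
  (forall n x, `|f_ n x| <= B) ->
  (forall x, E x -> f_ n x @[n --> \oo] --> f x) ->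
  \int[m]_(x in E) f_ n x @[n --> \oo] --> \int[m]_(x in E) f x.
Proof.
move=> mE mf_ mf f_B f_f.
have h1 n : measurable_fun E (fun x => (f_ n x)%:E).
  by apply/measurable_EFinP; exact: measurable_funTS.
have h2 : measurable_fun E (fun x => (f x)%:E).
  by apply/measurable_EFinP; exact: measurable_funTS.
have h3 : {ae m, forall x, E x -> (f_ n x)%:E @[n --> \oo] --> (f x)%:E}.
  by apply: aeW => x Ex; apply: cvg_EFin; [exact: nearW|exact: f_f].
have h4 : {ae m, forall x n, E x -> (`|(f_ n x)%:E| <= B%:E)%E}.
  by apply: aeW => x n _ /=; rewrite lee_fin.
have [fi _ cv] :=
  dominated_convergence mE h1 h2 h3 (bm_integrable m mE (bm_cst B)) h4.
have ffin : (\int[m]_(x in E) (f x)%:E)%E \is a fin_num.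
  exact: integrable_fin_num.
by apply: fine_cvg; rewrite /Rintegral fineK.
Qed.

End bounded_measurable.

Lemma bm_Rintegral_comp d1 d2 (X : measurableType d1) (Y : measurableType d2)
    (R : realType) (m1 : probability X R) (m2 : probability Y R) (T : X -> Y)
    (E : set Y) (f : Y -> R) :
  measurable_fun setT T ->
  (forall A, measurable A -> m1 (T @^-1` A) = m2 A) ->
  measurable E -> bounded_measurable f ->
  \int[m1]_(x in T @^-1` E) f (T x) = \int[m2]_(y in E) f y.
Proof.
move=> mT Tm mE [mf [B fB]]; rewrite /Rintegral; congr fine.
have -> : (\int[m2]_(y in E) (f y)%:E = \int[pushforward m1 T]_(y in E) (f y)%:E)%E.
  by apply: eq_measure_integral => A mA _; exact/esym/Tm.
rewrite integral_pushforward //.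
  exact: measurableT_comp.
apply: bm_integrable; first by rewrite -[X in measurable X]setTI; exact: mT.
by split; [exact: measurableT_comp|exists B].
Qed.

(** * Real and imaginary parts of characters *)

Section real_imaginary.
Variable R : realType.
Implicit Types z w : R[i].

Lemma Re_mulc z w :
  complex.Re (z * w) = complex.Re z * complex.Re w - complex.Im z * complex.Im w.
Proof. by case: z w => [a b] [c e]. Qed.

Lemma Im_mulc z w :
  complex.Im (z * w) = complex.Re z * complex.Im w + complex.Im z * complex.Re w.
Proof. by case: z w => [a b] [c e]. Qed.

Lemma Re_subc z w : complex.Re (z - w) = complex.Re z - complex.Re w.
Proof. by case: z w => [a b] [c e]. Qed.

Lemma Im_subc z w : complex.Im (z - w) = complex.Im z - complex.Im w.
Proof. by case: z w => [a b] [c e]. Qed.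

Lemma normc_lt_Re_Im z (e : R) :
  (`|z| < e%:C%C) = (0 < e) && (complex.Re z ^+ 2 + complex.Im z ^+ 2 < e ^+ 2).
Proof.
rewrite normc_def ltcR; have h : 0 <= complex.Re z ^+ 2 + complex.Im z ^+ 2.
  by rewrite addr_ge0 ?sqr_ge0.
have [e0|e0] := ltP 0 e; last first.
  by apply/negbTE; rewrite -leNgt (le_trans e0) // sqrtr_ge0.
by rewrite -(ltr_pXn2r (n := 2)) ?nnegrE ?sqrtr_ge0 ?(ltW e0) // sqr_sqrtr.
Qed.

Lemma Re_continuous : continuous (@complex.Re R : R[i]^o -> R^o).
Proof.
move=> z A [e /= e0 eA].
exists (e%:C%C); first by rewrite /= -[0]/((0 : R)%:C%C) ltcR.
move=> w /=; rewrite normc_lt_Re_Im => /andP[_ h]; apply: eA => /=.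
rewrite -Re_subc -(ltr_pXn2r (n := 2)) ?nnegrE ?(ltW e0) // real_normK ?num_real //.
by rewrite (le_lt_trans _ h) // lerDl sqr_ge0.
Qed.

Lemma Im_continuous : continuous (@complex.Im R : R[i]^o -> R^o).
Proof.
move=> z A [e /= e0 eA].
exists (e%:C%C); first by rewrite /= -[0]/((0 : R)%:C%C) ltcR.
move=> w /=; rewrite normc_lt_Re_Im => /andP[_ h]; apply: eA => /=.
rewrite -Im_subc -(ltr_pXn2r (n := 2)) ?nnegrE ?(ltW e0) // real_normK ?num_real //.
by rewrite (le_lt_trans _ h) // lerDr sqr_ge0.
Qed.

End real_imaginary.

Section dual_cos_sin.
Variables (R : realType) (V : zmodType).
Implicit Types (xi eta : dual R V) (v w : V).

Definition dcos xi v : R := complex.Re (xi v).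
Definition dsin xi v : R := complex.Im (xi v).

Lemma dual0 xi : xi 0 = 1.
Proof.
have x0 : xi 0 != 0 by rewrite -normr_eq0 dual_norm1 oner_neq0.
by apply: (mulfI x0); rewrite -dual_add addr0 mulr1.
Qed.

Lemma dcos0 xi : dcos xi 0 = 1. Proof. by rewrite /dcos dual0. Qed.
Lemma dsin0 xi : dsin xi 0 = 0. Proof. by rewrite /dsin dual0. Qed.

Lemma dcos2Ddsin2 xi v : dcos xi v ^+ 2 + dsin xi v ^+ 2 = 1.
Proof.
have := dual_norm1 xi v; rewrite normc_def => -[h].
rewrite /dcos /dsin -[LHS]sqr_sqrtr ?h ?expr1n //.
by rewrite addr_ge0 ?sqr_ge0.
Qed.

Lemma dcosD xi v w :
  dcos xi (v + w) = dcos xi v * dcos xi w - dsin xi v * dsin xi w.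
Proof. by rewrite /dcos dual_add Re_mulc. Qed.

Lemma dsinD xi v w :
  dsin xi (v + w) = dcos xi v * dsin xi w + dsin xi v * dcos xi w.
Proof. by rewrite /dsin dual_add Im_mulc. Qed.

Lemma dual_oppr xi v : dcos xi (- v) = dcos xi v /\ dsin xi (- v) = - dsin xi v.
Proof.
have := dcos2Ddsin2 xi v; have := dcosD xi v (- v); have := dsinD xi v (- v).
rewrite subrr dcos0 dsin0.
set c := dcos xi v; set s := dsin xi v; set c' := dcos _ _; set s' := dsin _ _.
move=> e1 e2 e3; split.
  have : c * (c * c' - s * s') + s * (c * s' + s * c') = (c ^+ 2 + s ^+ 2) * c'.
    by ring.
  by rewrite -e2 -e1 e3 mulr1 mulr0 addr0 mul1r => <-.
have : c * (c * s' + s * c') - s * (c * c' - s * s') = (c ^+ 2 + s ^+ 2) * s'.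
  by ring.
by rewrite -e2 -e1 e3 mulr1 mulr0 sub0r mul1r => <-.
Qed.

Lemma dcosN xi v : dcos xi (- v) = dcos xi v.
Proof. by case: (dual_oppr xi v). Qed.

Lemma dsinN xi v : dsin xi (- v) = - dsin xi v.
Proof. by case: (dual_oppr xi v). Qed.

Lemma dcosB xi v w :
  dcos xi (v - w) = dcos xi v * dcos xi w + dsin xi v * dsin xi w.
Proof. by rewrite dcosD dcosN dsinN mulrN opprK. Qed.

Lemma dcos_le1 xi v : `|dcos xi v| <= 1.
Proof.
rewrite -(ler_pXn2r (n := 2)) ?nnegrE // expr1n real_normK ?num_real //.
by rewrite -(dcos2Ddsin2 xi v) lerDl sqr_ge0.
Qed.

Lemma dsin_le1 xi v : `|dsin xi v| <= 1.
Proof.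
rewrite -(ler_pXn2r (n := 2)) ?nnegrE // expr1n real_normK ?num_real //.
by rewrite -(dcos2Ddsin2 xi v) lerDr sqr_ge0.
Qed.

Lemma dcos_eq1 xi v : (dcos xi v == 1) = (xi v == 1).
Proof.
rewrite eq_complex /=; case: eqP => [c1|//]; rewrite [RHS]/= -/(dsin xi v).
have := dcos2Ddsin2 xi v; rewrite c1 expr1n => /(canRL (addKr _)).
by rewrite addNr => /eqP; rewrite sqrf_eq0 => ->.
Qed.

Lemma continuous_eval v : continuous (fun xi : dual R V => (xi v : R[i]^o)).
Proof. by move=> xi; have /cvg_dual : nbhs xi --> xi by []; exact. Qed.

Lemma continuous_dcos v : continuous (fun xi : dual R V => dcos xi v : R^o).
Proof.
move=> xi; apply: (@continuous_comp _ _ _ _ (@complex.Re R : R[i]^o -> R^o)).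
  exact: continuous_eval.
exact: Re_continuous.
Qed.

Lemma continuous_dsin v : continuous (fun xi : dual R V => dsin xi v : R^o).
Proof.
move=> xi; apply: (@continuous_comp _ _ _ _ (@complex.Im R : R[i]^o -> R^o)).
  exact: continuous_eval.
exact: Im_continuous.
Qed.

Lemma continuous_dual_measurable (f : dual R V -> R) :
  continuous (f : dual R V -> R^o) -> measurable_fun setT f.
Proof.
move=> cf; apply: (measurability (@RGenOInfty.G R)).
  exact: RGenOInfty.measurableE.
move=> _ [_ [a ->] <-]; rewrite setTI; apply: sub_sigma_algebra.
apply: open_comp; first by move=> x _; exact: cf.
exact: interval_open.
Qed.

Lemma bm_dcos v : bounded_measurable (fun xi : dual R V => dcos xi v).
Proof.
split; first by apply: continuous_dual_measurable; exact: continuous_dcos.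
by exists 1 => xi; exact: dcos_le1.
Qed.

Lemma bm_dsin v : bounded_measurable (fun xi : dual R V => dsin xi v).
Proof.
split; first by apply: continuous_dual_measurable; exact: continuous_dsin.
by exists 1 => xi; exact: dsin_le1.
Qed.

End dual_cos_sin.

Definition pair_dual (R : realType) (K L : zmodType)
  (p : dual R K * dual R L) : dual R (K * L)%type.
Proof.
exists (fun v => p.1 v.1 * p.2 v.2) => [v|v w].
  by rewrite normrM !dual_norm1 mulr1.
by rewrite !dual_add mulrACA.
Defined.

Section pair_dual.
Variables (R : realType) (K L : zmodType).
Implicit Types (p : dual R K * dual R L) (v : K * L).

Lemma dcos_pair p v : dcos (pair_dual p) v =
  dcos p.1 v.1 * dcos p.2 v.2 - dsin p.1 v.1 * dsin p.2 v.2.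
Proof. by rewrite /dcos Re_mulc. Qed.

Lemma dsin_pair p v : dsin (pair_dual p) v =
  dcos p.1 v.1 * dsin p.2 v.2 + dsin p.1 v.1 * dcos p.2 v.2.
Proof. by rewrite /dsin Im_mulc. Qed.

Lemma bm_comp d1 d2 (X : measurableType d1) (Y : measurableType d2)
    (g : X -> Y) (f : Y -> R) : measurable_fun setT g ->
  bounded_measurable f -> bounded_measurable (f \o g).
Proof.
move=> mg [mf [B fB]]; split; first exact: measurableT_comp.
by exists B => x; exact: fB.
Qed.

Lemma bm_dcos_pair v :
  bounded_measurable (fun p : dual R K * dual R L => dcos (pair_dual p) v).
Proof.
under eq_fun do rewrite dcos_pair.
apply: bmB; apply: bmM.
- exact: (bm_comp measurable_fst (bm_dcos _ v.1)).
- exact: (bm_comp measurable_snd (bm_dcos _ v.2)).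
- exact: (bm_comp measurable_fst (bm_dsin _ v.1)).
- exact: (bm_comp measurable_snd (bm_dsin _ v.2)).
Qed.

Lemma bm_dsin_pair v :
  bounded_measurable (fun p : dual R K * dual R L => dsin (pair_dual p) v).
Proof.
under eq_fun do rewrite dsin_pair.
apply: bmD; apply: bmM.
- exact: (bm_comp measurable_fst (bm_dcos _ v.1)).
- exact: (bm_comp measurable_snd (bm_dsin _ v.2)).
- exact: (bm_comp measurable_fst (bm_dsin _ v.1)).
- exact: (bm_comp measurable_snd (bm_dcos _ v.2)).
Qed.

End pair_dual.

(** * Positive definiteness of Fourier coefficients *)

Section fourier.
Context {d : measure_display} {X : measurableType d} {R : realType}
  {V : zmodType}.
Variables (J : X -> dual R V) (m : probability X R) (E : set X).
Hypothesis mE : measurable E.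
Hypothesis bm_cosJ : forall v, bounded_measurable (fun p => dcos (J p) v).
Hypothesis bm_sinJ : forall v, bounded_measurable (fun p => dsin (J p) v).

(** The sum of the characters [v0 + v], for [v] in [s], has squared modulus the
    sum of the real parts of the characters [v - w]. *)
Lemma fourier_positive (s : seq V) (v0 : V) :
  (\sum_(v <- s) \int[m]_(p in E) dcos (J p) (v0 + v)) ^+ 2 <=
    \sum_(v <- s) \sum_(w <- s) \int[m]_(p in E) dcos (J p) (v - w) /\
  (\sum_(v <- s) \int[m]_(p in E) dsin (J p) (v0 + v)) ^+ 2 <=
    \sum_(v <- s) \sum_(w <- s) \int[m]_(p in E) dcos (J p) (v - w).
Proof.
pose u p := \sum_(v <- s) dcos (J p) (v0 + v).
pose u' p := \sum_(v <- s) dsin (J p) (v0 + v).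
have bu : bounded_measurable u by exact: bm_sum.
have bu' : bounded_measurable u' by exact: bm_sum.
have bc2 : bounded_measurable (fun p => u p ^+ 2 + u' p ^+ 2).
  by apply: bmD; exact: bm_exp.
have <- : \int[m]_(p in E) (u p ^+ 2 + u' p ^+ 2) =
    \sum_(v <- s) \sum_(w <- s) \int[m]_(p in E) dcos (J p) (v - w).
  under [RHS]eq_bigr do rewrite -bm_Rintegral_sum //.
  rewrite -bm_Rintegral_sum //; last by move=> v; exact: bm_sum.
  apply: eq_Rintegral => p _; rewrite !expr2 !big_distrlr -big_split /=.
  apply: eq_bigr => v _; rewrite -big_split; apply: eq_bigr => w _ /=.
  by rewrite -dcosB opprD addrACA subrr add0r.
rewrite -!bm_Rintegral_sum //; split.
  apply: le_trans (bm_Rintegral_sqr m mE bu) _.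
  apply: bm_le_Rintegral => //; first exact: bm_exp.
  by move=> p _; rewrite lerDl sqr_ge0.
apply: le_trans (bm_Rintegral_sqr m mE bu') _.
apply: bm_le_Rintegral => //; first exact: bm_exp.
by move=> p _; rewrite lerDr sqr_ge0.
Qed.

End fourier.

(** * Uniqueness of Fourier coefficients *)

Section polynomial_step.
Variable R : realType.

Lemma bernoulli_ge (a : R) n : -1 <= a -> 1 + n%:R * a <= (1 + a) ^+ n.
Proof.
move=> a1; elim: n => [|n IH]; first by rewrite mul0r addr0 expr0.
rewrite exprS; apply: le_trans (ler_wpM2l _ IH); last by lra.
rewrite -natr1; have : 0 <= n%:R * a ^+ 2 by rewrite mulr_ge0 ?sqr_ge0.
nra.
Qed.

(** With [y = sqrt x], Bernoulli's inequality bounds [n * y ^ n], and [x ^ n] is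
    smaller by the factor [y ^ n]. *)
Lemma cvg_natM_expr (x : R) : 0 <= x -> x < 1 ->
  n%:R * x ^+ n @[n --> \oo] --> (0 : R).
Proof.
move=> x0 x1; set y := Num.sqrt x.
have y0 : 0 <= y by exact: sqrtr_ge0.
have y1 : y < 1 by rewrite -sqrtr1 ltr_sqrt.
have yx : y ^+ 2 = x by rewrite sqr_sqrtr.
have bnd n : n%:R * y ^+ n <= 1 / (1 - y).
  have := bernoulli_ge n (_ : -1 <= (1 - y)); rewrite ler_pdivlMr ?subr_gt0 //.
  have h : n%:R * (1 - y) <= (1 + (1 - y)) ^+ n.
    by rewrite (le_trans _ (bernoulli_ge n _)) ?lerDr //; lra.
  move=> _; rewrite mulrAC (le_trans (ler_wpM2r (exprn_ge0 _ y0) h)) //.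
  rewrite -exprMn exprn_ile1 //; first by apply: mulr_ge0 => //; lra.
  have : 0 <= (1 - y) ^+ 2 by exact: sqr_ge0.
  nra.
apply: (@squeeze_cvgr _ _ _ _ (fun=> 0) (fun n => 1 / (1 - y) * y ^+ n)).
- apply: nearW => n; rewrite mulr_ge0 ?exprn_ge0 //=.
  by rewrite -yx -exprM mul2n -addnn exprD mulrA ler_wpM2r // exprn_ge0.
- exact: cvg_cst.
- rewrite -[X in _ --> X](mulr0 (1 / (1 - y))).
  by apply: cvgMr; apply: cvg_expr; rewrite ger0_norm.
Qed.

(** For [0 <= t <= 1] and [a = t ^+ m], Bernoulli's inequality bounds
    [(1 - a) ^+ j] below by [1 - j * a] and above by [1 / (1 + j * a)]; with
    [j = m * k ^ m] the quantity [j * a = m * (k * t) ^+ m] tends to [0] for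
    [k * t < 1] and is at least [m] otherwise. *)
Lemma cvg_polynomial_step (t : R) (k : nat) : 0 <= t <= 1 ->
  (1 - t ^+ m) ^+ (m * k ^ m) @[m --> \oo] --> ((k%:R * t < 1)%R%:R : R).
Proof.
move=> /andP[t0 t1].
have tm m : 0 <= t ^+ m <= 1 by rewrite exprn_ge0 // exprn_ile1.
have jaE m : (m * k ^ m)%:R * t ^+ m = m%:R * (k%:R * t) ^+ m :> R.
  by rewrite natrM natrX exprMn mulrA.
have [x1|x1] := ltP (k%:R * t) 1.
  apply: (@squeeze_cvgr _ _ _ _ (fun m => 1 - m%:R * (k%:R * t) ^+ m) (fun=> 1)).
  - apply: nearW => m; have /andP[a0 a1] := tm m; apply/andP; split.
      rewrite -jaE -mulrN; apply: bernoulli_ge; lra.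
    apply: exprn_ile1; lra.
  - rewrite -[X in _ --> X]subr0; apply: cvgB; first exact: cvg_cst.
    by apply: cvg_natM_expr => //; rewrite mulr_ge0.
  - exact: cvg_cst.
apply: (@squeeze_cvgr _ _ _ _ (fun=> 0) (@harmonic R)).
- apply: nearW => m; have /andP[a0 a1] := tm m.
  rewrite exprn_ge0 ?subr_ge0 //= -div1r ler_pdivlMr ?ltr0n //.
  have h : m.+1%:R <= (1 + t ^+ m) ^+ (m * k ^ m).
    apply: le_trans (bernoulli_ge _ _); last by lra.
    by rewrite -natr1 jaE addrC lerD2l ler_peMr // exprn_ege1.
  rewrite (le_trans (ler_wpM2l _ h)) ?exprn_ge0 ?subr_ge0 //.
  rewrite -exprMn exprn_ile1 //.
    by rewrite mulr_ge0 ?subr_ge0 // addr_ge0.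
  have : 0 <= (t ^+ m) ^+ 2 by exact: sqr_ge0.
  nra.
- exact: cvg_cst.
- exact: cvg_harmonic.
Qed.

End polynomial_step.

Section uniqueness.
Context {d : measure_display} {X : measurableType d} {R : realType}
  {V : zmodType}.
Variables (J : X -> dual R V) (m1 m2 : probability X R).
Hypothesis bm_cosJ : forall v, bounded_measurable (fun p => dcos (J p) v).
Hypothesis bm_sinJ : forall v, bounded_measurable (fun p => dsin (J p) v).

(** Unlike the trigonometric polynomials, these densities are stable both under
    multiplication by characters and under bounded pointwise limits. *)
Definition indistinguishing (f : X -> R) := [/\ bounded_measurable f,
  forall v, \int[m1]_p (f p * dcos (J p) v) = \int[m2]_p (f p * dcos (J p) v) &
  forall v, \int[m1]_p (f p * dsin (J p) v) = \int[m2]_p (f p * dsin (J p) v)].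

Lemma indistinguishingZ a f :
  indistinguishing f -> indistinguishing (fun p => a * f p).
Proof.
move=> [bf fc fs]; split=> [|v|v]; first exact: bmZ.
  under eq_Rintegral do rewrite -mulrA; under [RHS]eq_Rintegral do rewrite -mulrA.
  by rewrite !bm_RintegralZ ?fc //; exact: bmM.
under eq_Rintegral do rewrite -mulrA; under [RHS]eq_Rintegral do rewrite -mulrA.
by rewrite !bm_RintegralZ ?fs //; exact: bmM.
Qed.

Lemma indistinguishingD f g : indistinguishing f -> indistinguishing g ->
  indistinguishing (fun p => f p + g p).
Proof.
move=> [bf fc fs] [bg gc gs]; split=> [|v|v]; first exact: bmD.
  under eq_Rintegral do rewrite mulrDl; under [RHS]eq_Rintegral do rewrite mulrDl.
  by rewrite !bm_RintegralD ?fc ?gc //; exact: bmM.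
under eq_Rintegral do rewrite mulrDl; under [RHS]eq_Rintegral do rewrite mulrDl.
by rewrite !bm_RintegralD ?fs ?gs //; exact: bmM.
Qed.

Lemma eq_indistinguishing f g : f =1 g -> indistinguishing f ->
  indistinguishing g.
Proof. by move=> /funext ->. Qed.

Let eq_linear (a b : R) g h k : bounded_measurable g -> bounded_measurable h ->
  (forall p, k p = a * g p + b * h p) ->
  \int[m1]_p g p = \int[m2]_p g p -> \int[m1]_p h p = \int[m2]_p h p ->
  \int[m1]_p k p = \int[m2]_p k p.
Proof.
move=> bg bh kgh eg eh; have bag := bmZ a bg; have bbh := bmZ b bh.
have kE (m : probability X R) :
    \int[m]_p k p = a * \int[m]_p g p + b * \int[m]_p h p.
  rewrite -(bm_RintegralZ m a measurableT bg).
  rewrite -(bm_RintegralZ m b measurableT bh).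
  rewrite -(bm_RintegralD m measurableT bag bbh).
  by apply: eq_Rintegral => p _; exact: kgh.
by rewrite !kE eg eh.
Qed.

Lemma indistinguishing_cos w f :
  indistinguishing f -> indistinguishing (fun p => f p * dcos (J p) w).
Proof.
move=> [bf fc fs].
split=> [|v|v]; first exact: bmM.
  apply: (@eq_linear 2^-1 2^-1 _ _ _ (bmM bf (bm_cosJ (w + v)))
    (bmM bf (bm_cosJ (w - v)))) => // p.
  by rewrite dcosD dcosB; field.
apply: (@eq_linear 2^-1 2^-1 _ _ _ (bmM bf (bm_sinJ (v + w)))
  (bmM bf (bm_sinJ (v - w)))) => // p.
by rewrite !dsinD dcosN dsinN; field.
Qed.

Lemma indistinguishing_sin w f :
  indistinguishing f -> indistinguishing (fun p => f p * dsin (J p) w).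
Proof.
move=> [bf fc fs].
split=> [|v|v]; first exact: bmM.
  apply: (@eq_linear 2^-1 (- 2^-1) _ _ _ (bmM bf (bm_sinJ (v + w)))
    (bmM bf (bm_sinJ (v - w)))) => // p.
  by rewrite !dsinD dcosN dsinN; field.
apply: (@eq_linear 2^-1 (- 2^-1) _ _ _ (bmM bf (bm_cosJ (w - v)))
  (bmM bf (bm_cosJ (w + v)))) => // p.
by rewrite dcosB dcosD; field.
Qed.

Lemma indistinguishing_lim (f_ : nat -> X -> R) (f : X -> R) (B : R) :
  (forall n, indistinguishing (f_ n)) -> bounded_measurable f ->
  (forall n p, `|f_ n p| <= B) ->
  (forall p, f_ n p @[n --> \oo] --> f p) -> indistinguishing f.
Proof.
move=> gf_ bf f_B f_f.
have key (h : X -> R) : bounded_measurable h -> (forall p, `|h p| <= 1) ->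
    (forall n, \int[m1]_p (f_ n p * h p) = \int[m2]_p (f_ n p * h p)) ->
    \int[m1]_p (f p * h p) = \int[m2]_p (f p * h p).
  move=> bh h1 eqn.
  have cv (m : probability X R) :
      \int[m]_p (f_ n p * h p) @[n --> \oo] --> \int[m]_p (f p * h p).
    apply: (@bm_dominated _ _ _ _ _ _ _ B) => //.
    - move=> n; have [bn _ _] := gf_ n; exact: (bmM bn bh).1.
    - exact: (bmM bf bh).1.
    - move=> n p; rewrite normrM (le_trans _ (f_B n p)) //.
      by rewrite ler_piMr.
    - by move=> p _; apply: cvgM; [exact: f_f|exact: cvg_cst].
  have c1 := cv m1; have c2 := cv m2.
  rewrite (_ : (fun n => \int[m1]_p (f_ n p * h p)) =
    (fun n => \int[m2]_p (f_ n p * h p))) in c1; last exact/funext.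
  exact: (cvg_unique _ c1 c2).
split=> // v; apply: key => //.
- by move=> p; exact: dcos_le1.
- by move=> n; have [_ fc _] := gf_ n.
- by move=> p; exact: dsin_le1.
- by move=> n; have [_ _ fs] := gf_ n.
Qed.

(** The ball is the set [k * t < 1] for [t] a multiple of the squared distance
    to its centre, which on the circle is an affine function of [dcos] and
    [dsin]. *)
Lemma indistinguishing_ball v (c : rat * rat) n f :
  indistinguishing f ->
  indistinguishing (fun p => f p * (`[< qball c n (J p v) >])%:R).
Proof.
move=> gf.
pose a : R := ratr c.1; pose b : R := ratr c.2.
pose D p := (dcos (J p) v - a) ^+ 2 + (dsin (J p) v - b) ^+ 2.
have ballE p : `[< qball c n (J p v) >] = (D p < n.+1%:R^-1 ^+ 2).
  apply/asboolP; rewrite /qball /=.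
  have -> : n.+1%:R^-1 = (n.+1%:R^-1 : R)%:C%C :> R[i].
    by rewrite fmorphV rmorph_nat.
  rewrite normc_lt_Re_Im invr_gt0 ltr0n /= /qC /D.
  rewrite Re_subc Im_subc /= !mul0r !mul1r ?mulr0 ?addr0 ?add0r ?subr0.
  by rewrite -/a -/b; case: ifPn => // /negP.

have DE p : D p = (1 + a ^+ 2 + b ^+ 2) - 2 * a * dcos (J p) v
    - 2 * b * dsin (J p) v.
  by have := dcos2Ddsin2 (J p) v; rewrite /D => ?; lra.
have [M M1 DM] : exists2 M : nat, (0 < M)%N & forall p, D p <= M%:R.
  pose C := 1 + a ^+ 2 + b ^+ 2 + 2 * `|a| + 2 * `|b|.
  exists (Num.bound C).+1 => // p.
  have C0 : 0 <= C by rewrite /C !addr_ge0 ?sqr_ge0 // mulr_ge0.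
  have CM : C <= (Num.bound C).+1%:R.
    by rewrite (le_trans (ltW (archi_boundP C0))) // ler_nat.
  rewrite (le_trans _ CM) // DE /C.
  have /(le_trans (ler_norm _)) : `|- (a * dcos (J p) v)| <= `|a|.
    by rewrite normrN normrM ler_piMr // dcos_le1.
  have /(le_trans (ler_norm _)) : `|- (b * dsin (J p) v)| <= `|b|.
    by rewrite normrN normrM ler_piMr // dsin_le1.
  lra.
have M0 : 0 < M%:R :> R by rewrite ltr0n.
pose t p := M%:R^-1 * D p; pose k := (n.+1 ^ 2 * M)%N.
have t01 p : 0 <= t p <= 1.
  rewrite /t mulr_ge0 ?invr_ge0 ?(ltW M0) ?addr_ge0 ?sqr_ge0 //=.
  by rewrite mulrC ler_pdivrMr // mul1r.
have kt p : (k%:R * t p < 1) = (D p < n.+1%:R^-1 ^+ 2).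
  rewrite /k /t natrM natrX -mulrA mulVKf ?gt_eqF // exprVn.
  by rewrite -[X in _ = (_ < X)]div1r ltr_pdivlMr ?exprn_gt0 ?ltr0n // mulrC.
have gt g : indistinguishing g -> indistinguishing (fun p => g p * t p).
  move=> gg; apply: (@eq_indistinguishing (fun p =>
    (M%:R^-1 * (1 + a ^+ 2 + b ^+ 2)) * g p +
    ((- (M%:R^-1 * 2 * a)) * (g p * dcos (J p) v) +
    (- (M%:R^-1 * 2 * b)) * (g p * dsin (J p) v)))).
    by move=> p; rewrite /t DE; ring.
  apply: indistinguishingD; first exact: indistinguishingZ.
  apply: indistinguishingD; apply: indistinguishingZ.
    exact: indistinguishing_cos.
  exact: indistinguishing_sin.
have gtX j g : indistinguishing g -> indistinguishing (fun p => g p * t p ^+ j).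
  elim: j g => [|j IH] g gg.
    by apply: eq_indistinguishing gg => p; rewrite expr0 mulr1.
  apply: (@eq_indistinguishing (fun p => g p * t p * t p ^+ j)).
    by move=> p; rewrite exprS [RHS]mulrA.
  by apply: IH; exact: gt.
have gs1 j g : indistinguishing g ->
    indistinguishing (fun p => g p * (1 - t p ^+ j)).
  move=> gg; apply: (@eq_indistinguishing
    (fun p => g p + (-1) * (g p * t p ^+ j))); first by move=> p; ring.
  by apply: indistinguishingD => //; apply: indistinguishingZ; exact: gtX.
have gsX j i g : indistinguishing g ->
    indistinguishing (fun p => g p * (1 - t p ^+ j) ^+ i).
  elim: i g => [|i IH] g gg.
    by apply: eq_indistinguishing gg => p; rewrite expr0 mulr1.
  apply: (@eq_indistinguishing
    (fun p => g p * (1 - t p ^+ j) * (1 - t p ^+ j) ^+ i)).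
    by move=> p; rewrite exprS [RHS]mulrA.
  by apply: IH; exact: gs1.
have [bf _ _] := gf; have [B fB] := bf.2.
have bD : bounded_measurable D.
  by apply: bmD; apply: bm_exp; apply: bmB => //; exact: bm_cst.
apply: (@indistinguishing_lim
  (fun i p => f p * (1 - t p ^+ i) ^+ (i * k ^ i)) _ B).
- by move=> i; exact: gsX.
- apply: bmM => //; split.
    rewrite (_ : (fun p => _) = \1_[set p | D p < n.+1%:R^-1 ^+ 2]).
      apply: measurable_indic.
      rewrite (_ : mkset _ = D @^-1` `]-oo, (n.+1%:R^-1 ^+ 2)[%classic).
        by rewrite -[X in measurable X]setTI; apply: bD.1.
      by apply/seteqP; split=> p /=; rewrite in_itv.
    by apply/funext => p; rewrite indicE ballE mem_setE.
  by exists 1 => p; case: asbool; rewrite ?normr1 ?normr0.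
- move=> i p; rewrite normrM (le_trans _ (fB p)) // ler_piMr //.
  have /andP[t0 t1] := t01 p.
  rewrite ger0_norm ?exprn_ge0 ?subr_ge0 ?exprn_ile1 ?subr_ge0 ?exprn_ile1 //.
  by rewrite gerBl exprn_ge0.
- move=> p; apply: cvgMr; rewrite ballE -kt.
  exact: cvg_polynomial_step.
Qed.

Lemma indistinguishing_box (s : seq (V * ((rat * rat) * nat))) f :
  indistinguishing f ->
  indistinguishing (fun p => f p * (`[< qbox s (J p) >])%:R).
Proof.
elim: s f => [|q s IH] f gf.
  by apply: eq_indistinguishing gf => p; rewrite asboolT // mulr1.
have := IH _ (indistinguishing_ball q.1 q.2.1 q.2.2 gf).
apply: eq_indistinguishing => p; rewrite -mulrA -natrM mulnb -asbool_and.
congr (_ * (nat_of_bool _)%:R); apply: asbool_equiv_eq; split.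
  by move=> [h1 h2] x; rewrite inE => /orP[/eqP -> //|]; exact: h2.
by move=> h; split=> [|x xs]; apply: h; rewrite inE ?eqxx // xs orbT.
Qed.

Lemma indistinguishing_measure_box s : measurable (J @^-1` qbox s) ->
  (forall v, \int[m1]_p dcos (J p) v = \int[m2]_p dcos (J p) v) ->
  (forall v, \int[m1]_p dsin (J p) v = \int[m2]_p dsin (J p) v) ->
  m1 (J @^-1` qbox s) = m2 (J @^-1` qbox s).
Proof.
move=> mA hc hs.
have g1 : indistinguishing (fun=> 1).
  split=> [|v|v]; first exact: bm_cst.
    by under eq_Rintegral do rewrite mul1r; under [RHS]eq_Rintegral do rewrite mul1r.
  by under eq_Rintegral do rewrite mul1r; under [RHS]eq_Rintegral do rewrite mul1r.
have [_ /(_ 0) + _] := indistinguishing_box s g1.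
have intE (m : probability X R) :
    \int[m]_p (1 * (`[< qbox s (J p) >])%:R * dcos (J p) 0) =
    fine (m (J @^-1` qbox s)).
  rewrite (_ : (fun p => _) = \1_(J @^-1` qbox s)).
    by rewrite /Rintegral integral_indic // setIT.
  by apply/funext => p; rewrite dcos0 mul1r mulr1 indicE.
by rewrite !intE => e; rewrite -[LHS]fineK ?fin_num_measure // e fineK //
  fin_num_measure.
Qed.

End uniqueness.

(** The products of the basic open boxes are stable under intersection and
    generate the Borel sets; a box is a finite intersection of balls in the
    values of characters. *)
Theorem fourier_unique (R : realType) (K L : zmodType)
    (cK : countable [set: K]) (cL : countable [set: L])
    (m1 m2 : probability (dual R K * dual R L)%type R) :
  (forall v, \int[m1]_p dcos (pair_dual p) v = \int[m2]_p dcos (pair_dual p) v) ->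
  (forall v, \int[m1]_p dsin (pair_dual p) v = \int[m2]_p dsin (pair_dual p) v) ->
  forall A, measurable A -> m1 A = m2 A.
Proof.
move=> hc hs.
pose I : Type :=
  (seq (K * ((rat * rat) * nat)) * seq (L * ((rat * rat) * nat)))%type.
pose B (i : I) : set (dual R K * dual R L) := qbox i.1 `*` qbox i.2.
have mB i : measurable (B i).
  by apply: measurableX; apply: sub_sigma_algebra; exact: qbox_open.
have BE i : B i = @pair_dual R K L @^-1` qbox
    ([seq ((q.1, 0), q.2) | q <- i.1] ++ [seq ((0, q.1), q.2) | q <- i.2]).
  apply/seteqP; split=> p.
    move=> [h1 h2] q /=; rewrite mem_cat => /orP[|] /mapP[x xs ->] /=.
      by rewrite dual0 mulr1; exact: h1.
    by rewrite dual0 mul1r; exact: h2.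
  move=> h; split=> x xs.
    have := h ((x.1, 0), x.2); rewrite /= dual0 mulr1; apply.
    by rewrite mem_cat (map_f (fun q => ((q.1, 0), q.2))).
  have := h ((0, x.1), x.2); rewrite /= dual0 mul1r; apply.
  by rewrite mem_cat (map_f (fun q => ((0, q.1), q.2))) ?orbT.
apply: (measure_unique (range B) (fun=> setT)).
- rewrite measurable_dual_prod // eqEsubset; split.
    apply: smallest_sub; first exact: smallest_sigma_algebra.
    move=> O oO.
    rewrite (_ : O = \bigcup_(i : I) if `[< B i `<=` O >] then B i else set0).
      apply: (@countable_bigcupT_measurable _ (g_sigma_algebraType (range B))).
        by rewrite -setXTT; apply: countableX; exact: countable_seq.
      move=> i; case: ifP => // _; apply: sub_sigma_algebra; by exists i.
    rewrite eqEsubset; split => [[x y] Oxy|p [i _]]; last first.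
      by case: asboolP => // BO; exact: BO.
    have : nbhs (x, y) O by exact: open_nbhs_nbhs.
    move=> [[P Q] /= [/qbox_base[s [sx sP]] /qbox_base[t [ty tQ]]] PQ].
    exists (s, t) => //; rewrite asboolT; first by split.
    by move=> [u v] [/= us vt]; apply: PQ; split => /=; [exact: sP|exact: tQ].
  apply: smallest_sub; first exact: smallest_sigma_algebra.
  by move=> _ [i _ <-]; rewrite -measurable_dual_prod.
- move=> _ _ [i _ <-] [j _ <-]; exists (i.1 ++ j.1, i.2 ++ j.2) => //.
  have qcat (V : zmodType) (s t : seq (V * ((rat * rat) * nat))) :
      qbox (s ++ t) = qbox s `&` qbox t :> set (dual R V).
    apply/seteqP; split=> x.
      by move=> h; split=> q qs; apply: h; rewrite mem_cat qs ?orbT.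
    by move=> [h1 h2] q; rewrite mem_cat => /orP[]; [exact: h1|exact: h2].
  by rewrite /B /= !qcat setXI.
- move=> _; exists ([::], [::]) => //.
  by rewrite /B /=; apply/seteqP; split=> // p _; split.
- by rewrite bigcup_const //; exists 0%N.
- move=> _ [i _ <-]; rewrite BE; apply: indistinguishing_measure_box => //.
  + exact: bm_dcos_pair.
  + exact: bm_dsin_pair.
  + by rewrite -BE.
- by move=> _; rewrite -ge0_fin_numE // fin_num_measure.
Qed.

(** * Couplings of Haar measures *)

Section continuous_dual.
Variable R : realType.

Lemma continuous_to_dual (T : topologicalType) (V : zmodType)
    (f : T -> dual R V) :
  (forall v, continuous (fun t => (f t v : R[i]^o))) -> continuous f.
Proof. by move=> cf t; apply/cvg_dual => v; exact: cf. Qed.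

Lemma continuous_dual_measurable_fun (V W : zmodType)
    (f : dual R V -> dual R W) : continuous f -> measurable_fun setT f.
Proof.
move=> cf; apply: (measurability (@open (dual R W))) => // _ [A oA <-].
by rewrite setTI; apply: sub_sigma_algebra; apply: open_comp.
Qed.

Lemma continuous_dual_mul (V : zmodType) (xi : dual R V) :
  continuous (dual_mul xi).
Proof.
apply: continuous_to_dual => v eta.
apply: (@cvgM R[i]^o (dual R V) (nbhs eta) (nbhs_filter eta) (fun=> xi v)
  (fun zeta : dual R V => zeta v)); last exact: continuous_eval.
exact: (@cvg_cst _ _ _ (nbhs eta) (nbhs_filter eta)).
Qed.

Lemma continuous_dual_map (V W : zmodType) (kappa : {additive V -> W}) :
  continuous (@dual_map R V W kappa).
Proof. apply: continuous_to_dual => v. exact: (@continuous_eval R W (kappa v)). Qed.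

Lemma measurable_dual_mul (V : zmodType) (xi : dual R V) :
  measurable_fun setT (dual_mul xi).
Proof. by apply: continuous_dual_measurable_fun; exact: continuous_dual_mul. Qed.

Lemma measurable_dual_map (V W : zmodType) (kappa : {additive V -> W}) :
  measurable_fun setT (@dual_map R V W kappa).
Proof. by apply: continuous_dual_measurable_fun; exact: continuous_dual_map. Qed.

Lemma measurable_dual_scale (K : fieldType) (a : units K) :
  measurable_fun setT (@dual_scale R K a).
Proof. exact: measurable_dual_map. Qed.

Lemma measurable_diag_act (K L : fieldType) (rho : units K -> units L) a :
  measurable_fun setT (@diag_act R K L rho a).
Proof.
apply: measurable_fun_pair.
  exact: (measurableT_comp (measurable_dual_scale a) measurable_fst).
exact: (measurableT_comp (measurable_dual_scale (rho a)) measurable_snd).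
Qed.

End continuous_dual.

Section haar_coefficients.
Variable R : realType.

(** The rotation by the unit vector [(c, s)] fixes [(C, S)]. *)
Lemma rotation_fixed0 (c s C S : R) : c ^+ 2 + s ^+ 2 = 1 -> c != 1 ->
  C = c * C - s * S -> S = c * S + s * C -> C = 0 /\ S = 0.
Proof.
move=> cs c1 eC eS.
have c2 : 2 - 2 * c != 0 by apply/eqP => h; move/eqP: c1; apply; lra.
have h1 : (2 - 2 * c) * C = 0.
  have -> : (2 - 2 * c) * C = (c ^+ 2 + s ^+ 2 + 1 - 2 * c) * C.
    by rewrite cs; ring.
  have e1 : (c - 1) * C - s * S = 0 by rewrite mulrBl mul1r addrAC -eC subrr.
  have e2 : (c - 1) * S + s * C = 0 by rewrite mulrBl mul1r addrAC -eS subrr.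
  have -> : (c ^+ 2 + s ^+ 2 + 1 - 2 * c) * C =
    (c - 1) * ((c - 1) * C - s * S) + s * ((c - 1) * S + s * C) by ring.
  by rewrite e1 e2 !mulr0 addr0.
have h2 : (2 - 2 * c) * S = 0.
  have -> : (2 - 2 * c) * S = (c ^+ 2 + s ^+ 2 + 1 - 2 * c) * S.
    by rewrite cs; ring.
  have e1 : (c - 1) * C - s * S = 0 by rewrite mulrBl mul1r addrAC -eC subrr.
  have e2 : (c - 1) * S + s * C = 0 by rewrite mulrBl mul1r addrAC -eS subrr.
  have -> : (c ^+ 2 + s ^+ 2 + 1 - 2 * c) * S =
    (c - 1) * ((c - 1) * S + s * C) - s * ((c - 1) * C - s * S) by ring.
  by rewrite e1 e2 !mulr0 subr0.
by split; apply/eqP; [move/eqP: h1|move/eqP: h2]; rewrite mulf_eq0 (negbTE c2).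
Qed.

(** [T] multiplies the character at [v], hence its integral, by
    [zeta v != 1]. *)
Lemma translation_invariant_coef0 d (X : measurableType d) (V : zmodType)
    (J : X -> dual R V) (m : probability X R) (T : X -> X) (zeta : dual R V) v :
  bounded_measurable (fun p => dcos (J p) v) ->
  bounded_measurable (fun p => dsin (J p) v) ->
  measurable_fun setT T ->
  (forall A, measurable A -> m (T @^-1` A) = m A) ->
  (forall p, J (T p) v = zeta v * J p v) -> zeta v != 1 ->
  \int[m]_p dcos (J p) v = 0 /\ \int[m]_p dsin (J p) v = 0.
Proof.
move=> bc bs mT Tm JT zv.
have z1 : dcos zeta v != 1 by rewrite dcos_eq1.
apply: (rotation_fixed0 (dcos2Ddsin2 zeta v) z1).
  rewrite -{1}(bm_Rintegral_comp mT Tm measurableT bc) preimage_setT.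
  have -> : \int[m]_p dcos (J (T p)) v =
      \int[m]_p (dcos zeta v * dcos (J p) v + (- dsin zeta v) * dsin (J p) v).
    by apply: eq_Rintegral => p _; rewrite /dcos JT Re_mulc mulNr.
  by rewrite bm_RintegralD ?bm_RintegralZ ?mulNr //; exact: bmZ.
rewrite -{1}(bm_Rintegral_comp mT Tm measurableT bs) preimage_setT.
have -> : \int[m]_p dsin (J (T p)) v =
    \int[m]_p (dcos zeta v * dsin (J p) v + dsin zeta v * dcos (J p) v).
  by apply: eq_Rintegral => p _; rewrite /dsin JT Im_mulc.
by rewrite bm_RintegralD ?bm_RintegralZ //; exact: bmZ.
Qed.

Lemma haar_coef0 (V : zmodType) (m : probability (dual R V) R)
    (zeta : dual R V) v : is_haar m -> zeta v != 1 ->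
  \int[m]_xi dcos xi v = 0 /\ \int[m]_xi dsin xi v = 0.
Proof.
move=> hm zv; apply: (translation_invariant_coef0 (J := id) (T := dual_mul zeta)
  (bm_dcos R v) (bm_dsin R v) (measurable_dual_mul zeta) _ _ zv) => //.
by move=> A mA; exact: hm.
Qed.

Variables (K L : fieldType).
Variables (mK : probability (dual R K) R) (mL : probability (dual R L) R).
Hypotheses (haarK : is_haar mK) (haarL : is_haar mL).
Let X := (dual R K * dual R L)%type.

Lemma coupling_coef_fst (nu : probability X R) x : is_coupling mK mL nu ->
  \int[nu]_p dcos (pair_dual p) (x, 0) = \int[mK]_xi dcos xi x /\
  \int[nu]_p dsin (pair_dual p) (x, 0) = \int[mK]_xi dsin xi x.
Proof.
move=> [nuK _]; have nuK' A : measurable A -> nu (fst @^-1` A) = mK A by exact: nuK.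
rewrite -(bm_Rintegral_comp measurable_fst nuK' measurableT (bm_dcos R x)).
rewrite -(bm_Rintegral_comp measurable_fst nuK' measurableT (bm_dsin R x)).
rewrite !preimage_setT; split; apply: eq_Rintegral => p _.
  by rewrite dcos_pair /= dcos0 dsin0 mulr1 mulr0 subr0.
by rewrite dsin_pair /= dcos0 dsin0 mulr1 mulr0 add0r.
Qed.

Lemma coupling_coef_snd (nu : probability X R) y : is_coupling mK mL nu ->
  \int[nu]_p dcos (pair_dual p) (0, y) = \int[mL]_eta dcos eta y /\
  \int[nu]_p dsin (pair_dual p) (0, y) = \int[mL]_eta dsin eta y.
Proof.
move=> [_ nuL]; have nuL' A : measurable A -> nu (snd @^-1` A) = mL A by exact: nuL.
rewrite -(bm_Rintegral_comp measurable_snd nuL' measurableT (bm_dcos R y)).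
rewrite -(bm_Rintegral_comp measurable_snd nuL' measurableT (bm_dsin R y)).
rewrite !preimage_setT; split; apply: eq_Rintegral => p _.
  by rewrite dcos_pair /= dcos0 dsin0 mul1r mul0r subr0.
by rewrite dsin_pair /= dcos0 dsin0 mul1r mul0r addr0.
Qed.

Lemma product_coupling :
  is_coupling mK mL (mK \x mL)%E.
Proof.
split=> A mA; rewrite /pushforward.
  rewrite (_ : fst @^-1` A = A `*` setT); last first.
    by apply/seteqP; split=> p /=; [split|case].
  rewrite -[RHS]mule1 -(probability_setT mL).
  exact: product_measure1E.
rewrite (_ : snd @^-1` A = setT `*` A); last first.
  by apply/seteqP; split=> p /=; [split|case].
rewrite -[RHS]mul1e -(probability_setT mK).
exact: product_measure1E.
Qed.

Lemma product_coef0 (eta0 : dual R L) (x : K) (y : L) : eta0 y != 1 ->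
  \int[(mK \x mL)%E]_p dcos (pair_dual p) (x, y) = 0 /\
  \int[(mK \x mL)%E]_p dsin (pair_dual p) (x, y) = 0.
Proof.
move=> ey; pose T (p : X) : X := (p.1, dual_mul eta0 p.2).
have mT : measurable_fun setT T.
  apply: measurable_fun_pair; first exact: measurable_fst.
  exact: (measurableT_comp (measurable_dual_mul eta0) measurable_snd).
apply: (translation_invariant_coef0 (T := T)
  (zeta := pair_dual (dual_one R K, eta0)) (bm_dcos_pair _ _) (bm_dsin_pair _ _) mT).
- move=> A mA; apply: eq_integral => xi _ /=.
  rewrite (_ : xsection _ _ = dual_mul eta0 @^-1` xsection A xi).
    by apply: haarL; exact: measurable_xsection.
  by apply/seteqP; split=> eta; rewrite /xsection /= !inE.
- by move=> p /=; rewrite mul1r; ring.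
- by rewrite /= mul1r.
Qed.

Lemma dual_separates (V : fieldType) (x x' : V) (xi : dual R V) :
  x != 0 -> x' != 0 -> xi x != 1 -> exists xi' : dual R V, xi' x' != 1.
Proof.
move=> x0 x'0 xix; have u0 : x / x' != 0 by rewrite mulf_neq0 // invr_eq0.
exists (dual_scale (exist _ (x / x') u0) xi).
by rewrite /dual_scale /dual_map /= divfK.
Qed.

(** If the characters of [K] or of [L] were all trivial, every coupling would be
    trivial; so a nontrivial coupling also provides the characters that
    make the Fourier coefficients of the two Haar measures vanish. *)
Lemma nontrivial_coupling (nu : probability X R)
    (cK : countable [set: K]) (cL : countable [set: L]) :
  is_coupling mK mL nu -> ~ trivial_coupling mK mL nu ->
  [/\ exists x y, [/\ x != 0, y != 0 &
        \int[nu]_p dcos (pair_dual p) (x, y) != 0 \/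
        \int[nu]_p dsin (pair_dual p) (x, y) != 0],
     forall x, x != 0 -> \int[mK]_xi dcos xi x = 0 /\ \int[mK]_xi dsin xi x = 0 &
     forall y, y != 0 ->
       \int[mL]_eta dcos eta y = 0 /\ \int[mL]_eta dsin eta y = 0].
Proof.
move=> nuc nut; set P : probability X R := (mK \x mL)%E.
have Pc : is_coupling mK mL P := product_coupling.
have [[x y] xyP] : exists v, ~ (
    \int[nu]_p dcos (pair_dual p) v = \int[P]_p dcos (pair_dual p) v /\
    \int[nu]_p dsin (pair_dual p) v = \int[P]_p dsin (pair_dual p) v).
  apply: contrapT => h; apply: nut.
  have {}h v : \int[nu]_p dcos (pair_dual p) v = \int[P]_p dcos (pair_dual p) v /\
      \int[nu]_p dsin (pair_dual p) v = \int[P]_p dsin (pair_dual p) v.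
    by apply: contrapT => hv; apply: h; exists v.
  move=> A mA; apply: (fourier_unique cK cL (m2 := P)) => // v.
    by case: (h v).
  by case: (h v).
have x0 : x != 0.
  apply/eqP => x0; apply: xyP; rewrite x0.
  have [-> ->] := coupling_coef_snd y nuc.
  by have [-> ->] := coupling_coef_snd y Pc.
have y0 : y != 0.
  apply/eqP => y0; apply: xyP; rewrite y0.
  have [-> ->] := coupling_coef_fst x nuc.
  by have [-> ->] := coupling_coef_fst x Pc.
have [eta0 eta0P] : exists eta0 : dual R L, eta0 y != 1.
  apply: contrapT => h; have y1 (eta : dual R L) : eta y = 1.
    by apply/eqP/negPn/negP => hy; apply: h; exists eta.
  have e1 (p : X) : pair_dual p (x, y) = pair_dual p (x, 0).
    by rewrite /= y1 dual0.
  have cE (m : probability X R) : \int[m]_p dcos (pair_dual p) (x, y) =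
      \int[m]_p dcos (pair_dual p) (x, 0).
    by apply: eq_Rintegral => p _; rewrite /dcos e1.
  have sE (m : probability X R) : \int[m]_p dsin (pair_dual p) (x, y) =
      \int[m]_p dsin (pair_dual p) (x, 0).
    by apply: eq_Rintegral => p _; rewrite /dsin e1.
  apply: xyP; rewrite !cE !sE; have [-> ->] := coupling_coef_fst x nuc.
  by have [-> ->] := coupling_coef_fst x Pc.
have [xi0 xi0P] : exists xi0 : dual R K, xi0 x != 1.
  apply: contrapT => h; have x1 (xi : dual R K) : xi x = 1.
    by apply/eqP/negPn/negP => hx; apply: h; exists xi.
  have e1 (p : X) : pair_dual p (x, y) = pair_dual p (0, y).
    by rewrite /= x1 dual0.
  have cE (m : probability X R) : \int[m]_p dcos (pair_dual p) (x, y) =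
      \int[m]_p dcos (pair_dual p) (0, y).
    by apply: eq_Rintegral => p _; rewrite /dcos e1.
  have sE (m : probability X R) : \int[m]_p dsin (pair_dual p) (x, y) =
      \int[m]_p dsin (pair_dual p) (0, y).
    by apply: eq_Rintegral => p _; rewrite /dsin e1.
  apply: xyP; rewrite !cE !sE; have [-> ->] := coupling_coef_snd y nuc.
  by have [-> ->] := coupling_coef_snd y Pc.
have [Pc0 Ps0] := product_coef0 x eta0P.
split.
- exists x, y; split=> //; apply: contrapT => h; apply: xyP.
  rewrite /P /= Pc0 Ps0; split; apply/eqP/negPn/negP => hh; apply: h.
    by left.
  by right.
- move=> x' x'0; have [xi' xi'P] := dual_separates x0 x'0 xi0P.
  exact: haar_coef0 haarK xi'P.
- move=> y' y'0; have [eta' eta'P] := dual_separates y0 y'0 eta0P.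
  exact: haar_coef0 haarL eta'P.
Qed.

End haar_coefficients.

(** * From a nontrivial coupling to a field isomorphism *)

Section extend_units.
Variables (K L : fieldType) (rho : {multiplicative units K -> units L}).
Hypothesis rho_bij : bijective rho.

Definition unit_ext (x : K) : L := if insub x is Some u then val (rho u) else 0.

Lemma unit_ext0 : unit_ext 0 = 0.
Proof. by rewrite /unit_ext insubF // eqxx. Qed.

Lemma unit_ext_val (u : units K) : unit_ext (val u) = val (rho u).
Proof. by rewrite /unit_ext valK. Qed.

Lemma unit_extM : {morph unit_ext : x y / x * y}.
Proof.
move=> x y; have [->|x0] := eqVneq x 0; first by rewrite mul0r unit_ext0 mul0r.
have [->|y0] := eqVneq y 0; first by rewrite mulr0 unit_ext0 mulr0.
pose u : units K := exist _ x x0; pose v : units K := exist _ y y0.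
have -> : x * y = val (u * v)%g by [].
by rewrite unit_ext_val gmulfM /= -!unit_ext_val.
Qed.

Lemma unit_ext_eq0 x : (unit_ext x == 0) = (x == 0).
Proof.
have [->|x0] := eqVneq x 0; first by rewrite unit_ext0 eqxx.
pose u : units K := exist _ x x0.
by rewrite -[x]/(val u) unit_ext_val; apply/negbTE/(valP (rho u)).
Qed.

Lemma unit_ext1 : unit_ext 1 = 1.
Proof.
have r0 : unit_ext 1 != 0 by rewrite unit_ext_eq0 oner_neq0.
by apply: (mulfI r0); rewrite -unit_extM !mulr1.
Qed.

Lemma unit_ext_inj : injective unit_ext.
Proof.
move=> x y e; have [x0|x0] := eqVneq x 0.
  by apply/esym/eqP; rewrite x0 -unit_ext_eq0 -e x0 unit_ext0.
have y0 : y != 0 by rewrite -unit_ext_eq0 -e unit_ext_eq0.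
pose u : units K := exist _ x x0; pose v : units K := exist _ y y0.
move: e; rewrite -[x]/(val u) -[y]/(val v) !unit_ext_val.
by move=> /val_inj /(bij_inj rho_bij) ->.
Qed.

Lemma unit_ext_surj y : exists x, unit_ext x = y.
Proof.
have [->|y0] := eqVneq y 0; first by exists 0; exact: unit_ext0.
have [g _ gK] := rho_bij; pose v : units L := exist _ y y0.
by exists (val (g v)); rewrite unit_ext_val gK.
Qed.

End extend_units.

Section coupling_isomorphism.
Variables (R : realType) (K L : fieldType).
Hypotheses (cK : countable [set: K]) (cL : countable [set: L]).
Hypothesis infK : infinite_set [set: K].
Variables (mK : probability (dual R K) R) (mL : probability (dual R L) R).
Hypotheses (haarK : is_haar mK) (haarL : is_haar mL).
Variable rho : {multiplicative units K -> units L}.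
Hypothesis rho_bij : bijective rho.
Variable nu : probability (dual R K * dual R L)%type R.
Hypothesis nu_coupling : is_coupling mK mL nu.
Hypothesis nu_inv : invariant_measure (diag_act rho) nu.
Hypothesis nu_nontrivial : ~ trivial_coupling mK mL nu.

Let r := unit_ext rho.
Let C x y := \int[nu]_p dcos (pair_dual p) (x, y).
Let S x y := \int[nu]_p dsin (pair_dual p) (x, y).

Lemma invariant_coef a x y : a != 0 ->
  C (a * x) (r a * y) = C x y /\ S (a * x) (r a * y) = S x y.
Proof.
move=> a0; pose u : units K := exist _ a a0.
have mu := measurable_diag_act (R := R) rho u.
have r_u : r a = val (rho u) by rewrite -unit_ext_val.
have cE := bm_Rintegral_comp mu (nu_inv u) measurableT (bm_dcos_pair R (x, y)).
have sE := bm_Rintegral_comp mu (nu_inv u) measurableT (bm_dsin_pair R (x, y)).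
by rewrite preimage_setT in cE sE; rewrite r_u; split; [exact: cE|exact: sE].
Qed.

Let C_le1 x y : C x y <= 1.
Proof.
have -> : 1 = \int[nu]_p (1 : R) :> R.
  by rewrite Rintegral_cst // [X in fine X](probability_setT nu) mul1r.
apply: bm_le_Rintegral => //; [exact: bm_dcos_pair|exact: bm_cst|].
by move=> p _; exact: le_trans (ler_norm _) (dcos_le1 _ _).
Qed.

Let CN x y : C (- x) (- y) = C x y.
Proof.
apply: eq_Rintegral => p _.
by rewrite -[(- x, - y)]/(- (x, y)) dcosN.
Qed.

Let vanishing := nontrivial_coupling haarK haarL cK cL nu_coupling nu_nontrivial.

Let C0 y : y != 0 -> C 0 y = 0.
Proof.
by case: vanishing => _ _ /[apply] -[+ _]; rewrite /C (coupling_coef_snd y nu_coupling).1.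
Qed.

(** Bessel's inequality: the characters at the points [(0, y)] are orthonormal,
    because the second marginal is a Haar measure. *)
Lemma large_coef_finite (e : R) : 0 < e ->
  finite_set [set y : L | y != 0 /\ e <= C 1 y].
Proof.
move=> e0; apply: contrapT => /infinite_set_fset.
pose n := (Num.bound (e ^- 2)).+1.
move=> /(_ n)[F FA nF].
pose s : seq (K * L) := [seq (0, y) | y <- F].
have [+ _] := @fourier_positive _ _ R _ (@pair_dual R K L) nu setT measurableT
  (@bm_dcos_pair R K L) (@bm_dsin_pair R K L) s (1, 0).
rewrite !big_map.
have -> : \sum_(y <- F) \int[nu]_p dcos (pair_dual p) ((1, 0) + (0, y)) =
    \sum_(y <- F) C 1 y.
  apply: eq_bigr => y _.
  by rewrite -[(1, 0) + (0, y)]/(1 + 0, 0 + y) addr0 add0r.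
have -> : \sum_(y <- F) \sum_(v <- s)
    \int[nu]_p dcos (pair_dual p) ((0, y) - v) = (size F)%:R.
  rewrite -sum1_size natr_sum !big_seq; apply: eq_bigr => y yF.
  rewrite big_map (bigD1_seq y) //= subrr big1 => [|z zy].
    rewrite addr0 (@eq_Rintegral _ _ _ _ _ (fun=> 1)); last first.
      by move=> p _; rewrite dcos0.
    by rewrite Rintegral_cst // [X in fine X](probability_setT nu) mul1r.
  rewrite -[(0, y) - (0, z)]/(0 - 0, y - z) subrr.
  by apply: C0; rewrite subr_eq0 eq_sym.
have nF' : n%:R <= (size F)%:R :> R by rewrite ler_nat.
have hC : (size F)%:R * e <= \sum_(y <- F) C 1 y.
  rewrite -sum1_size natr_sum mulr_suml !big_seq.
  by apply: ler_sum => y /FA [_ ?]; rewrite mul1r.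
have n1 : e ^- 2 < n%:R.
  by rewrite (lt_le_trans (archi_boundP _)) ?ler_nat // invr_ge0 sqr_ge0.
have F0 : 0 < (size F)%:R :> R.
  by rewrite (lt_le_trans _ nF') // (le_lt_trans _ n1) // invr_ge0 sqr_ge0.
apply/negP; rewrite -ltNge.
have : ((size F)%:R * e) ^+ 2 <= (\sum_(y <- F) C 1 y) ^+ 2.
  by rewrite ler_pXn2r // nnegrE ?(le_trans _ hC) // mulr_ge0 // ltW.
apply: lt_le_trans; rewrite exprMn expr2 -mulrA ltr_pMr // -ltr_pdivrMr ?exprn_gt0 //.
by rewrite div1r (lt_le_trans n1).
Qed.

(** Let [c] be a nonzero Fourier coefficient at [(1, y1)]. By invariance the
    characters at the points [(a, r a * y1)] all have integral [c], so among
    enough of them two must be substantially correlated. Their correlation is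
    the coefficient at [(1, (r a - r b) / r (a - b) * y1)], and only finitely
    many coefficients are large. *)
Lemma coupling_slopes : exists (T : seq L) (N : nat), forall s : seq K,
  uniq s -> all (fun a : K => a != 0) s -> size s = N ->
  ~~ pairwise (fun a b => r a - r b \notin [seq t * r (a - b) | t <- T]) s.
Proof.
have [[x [y [x0 y0 xy0]]] _ _] := vanishing.
have rx0 : r x != 0 by rewrite unit_ext_eq0.
pose y1 := y / r x.
have y10 : y1 != 0 by rewrite mulf_neq0 // invr_eq0.
have [CE SE] := invariant_coef 1 y1 x0.
rewrite mulr1 (_ : r x * y1 = y) in CE SE; last by rewrite mulrC divfK.
have [c [c0 cP]] : exists c : R, c != 0 /\ forall s : seq K,
    all (fun a : K => a != 0) s -> ((size s)%:R * c) ^+ 2 <=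
    \sum_(a <- s) \sum_(b <- s) C (a - b) ((r a - r b) * y1).
  have pos s := @fourier_positive _ _ R _ (@pair_dual R K L) nu setT measurableT
    (@bm_dcos_pair R K L) (@bm_dsin_pair R K L) [seq (a, r a * y1) | a <- s] 0.
  have posE (s : seq K) : \sum_(v <- [seq (a, r a * y1) | a <- s])
      \sum_(w <- [seq (a, r a * y1) | a <- s])
        \int[nu]_p dcos (pair_dual p) (v - w) =
      \sum_(a <- s) \sum_(b <- s) C (a - b) ((r a - r b) * y1).
    rewrite big_map; apply: eq_bigr => a _; rewrite big_map.
    by apply: eq_bigr => b _; rewrite mulrBl.
  case: xy0 => c0.
    exists (C x y); split=> // s s0; have [+ _] := pos s.
    rewrite posE big_map (_ : \sum_(j <- s) _ = (size s)%:R * C x y) //.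
    rewrite -sum1_size natr_sum mulr_suml big_seq [RHS]big_seq.
    apply: eq_bigr => a /(allP s0) a0; rewrite add0r mul1r CE.
    by have [+ _] := invariant_coef 1 y1 a0; rewrite mulr1.
  exists (S x y); split=> // s s0; have [_] := pos s.
  rewrite posE big_map (_ : \sum_(j <- s) _ = (size s)%:R * S x y) //.
  rewrite -sum1_size natr_sum mulr_suml big_seq [RHS]big_seq.
  apply: eq_bigr => a /(allP s0) a0; rewrite add0r mul1r SE.
  by have [_ +] := invariant_coef 1 y1 a0; rewrite mulr1.
have c2 : 0 < c ^+ 2 by rewrite exprn_even_gt0.
(* [N] correlations below [e] would give [(N * c) ^+ 2 <= N + N ^+ 2 * e], which
   fails as soon as [N * e > 1]. *)
pose e := c ^+ 2 / 2; have e0 : 0 < e by rewrite divr_gt0.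
have /finite_seqP[Q QE] := large_coef_finite e0.
pose N := (Num.bound (e^-1)).+1.
exists [seq z / y1 | z <- Q], N => s us s0 sN; apply/negP => spw.
pose q a b := (a == b) || (C (a - b) ((r a - r b) * y1) < e).
have : all2rel q s.
  rewrite -pairwise_all2rel; first last.
  - move=> a b; rewrite /q eq_sym; congr (_ || (_ < _)).
    by rewrite -CN opprB -mulNr opprB.
  - by move=> a; rewrite /q eqxx.
  apply: sub_pairwise spw => a b ab; rewrite /q.
  have [//|neq] := eqVneq a b; rewrite /= ltNge; apply/negP => Ce.
  case/negP: ab; apply/mapP; exists ((r a - r b) / r (a - b)); last first.
    by rewrite divfK // unit_ext_eq0 subr_eq0.
  have rab : r (a - b) != 0 by rewrite unit_ext_eq0 subr_eq0.
  apply/mapP; exists ((r a - r b) / r (a - b) * y1); last by rewrite mulfK.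
  have : [set z : L | z != 0 /\ e <= C 1 z] ((r a - r b) / r (a - b) * y1).
    split; first by rewrite !mulf_neq0 ?invr_eq0 // subr_eq0
      (inj_eq (unit_ext_inj rho_bij)).
    have ab0 : a - b != 0 by rewrite subr_eq0.
    have [<- _] := invariant_coef 1 ((r a - r b) / r (a - b) * y1) ab0.
    rewrite mulr1 (_ : _ * (_ * y1) = (r a - r b) * y1); last by field.
    exact: Ce.
  by rewrite QE.
move=> /allrelP sq.
have : \sum_(a <- s) \sum_(b <- s) C (a - b) ((r a - r b) * y1) <=
    \sum_(a <- s) (1 + N%:R * e).
  rewrite big_seq [leRHS]big_seq; apply: ler_sum => a sa.
  rewrite (bigD1_seq a) //=; apply: lerD; first exact: C_le1.
  rewrite -sN -sum1_size natr_sum mulr_suml.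
  rewrite big_seq_cond [leRHS](bigID (fun b => b != a)) /= [leRHS]addrC.
  rewrite -[leLHS]add0r; apply: lerD.
    by apply: sumr_ge0 => b _; rewrite mul1r ltW.
  rewrite [leRHS]big_seq_cond; apply: ler_sum => b /andP[sb ba]; rewrite mul1r.
  by have := sq a b sa sb; rewrite /q eq_sym (negbTE ba) /= => /ltW.
rewrite big_const_seq count_predT iter_addr addr0 sN => hle.
have := le_trans (cP s s0) hle; rewrite sN exprMn.
have ce : c ^+ 2 = 2 * e by rewrite /e; field.
have N0 : 0 < N%:R :> R by rewrite ltr0n.
rewrite -[leRHS]mulr_natl ce expr2 -mulrA ler_pM2l //.
have : e^-1 < N%:R.
  by rewrite (lt_le_trans (archi_boundP _)) ?ler_nat // invr_ge0 ltW.
rewrite -div1r ltr_pdivrMr //; lra.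
Qed.

Lemma coupling_isomorphism : exists (w : {multiplicative units K -> units L})
    (kappa : {rmorphism K -> L}),
  [/\ finite_set (range w), kappa =1 twist w rho & bijective kappa].
Proof.
have [T [N TN]] := coupling_slopes.
have [kappa [M [kappa_bij kappaM]]] := almost_additive_isomorphism infK
  (unit_ext0 rho) (unit_ext1 rho) (unit_extM rho) (unit_ext_inj rho_bij)
  (unit_ext_surj rho_bij) TN.
have w0 (u : units K) : kappa (val u) / val (rho u) != 0.
  by rewrite mulf_neq0 ?invr_eq0 ?fmorph_eq0 //; [exact: (valP u)|exact: (valP (rho u))].
pose w u : units L := exist (fun y => is_true (y != 0)) _ (w0 u).
have wM : {morph w : u v / (u * v)%g >-> (u * v)%g}.
  move=> u v; apply: val_inj => /=; rewrite rmorphM gmulfM /=.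
  by rewrite invfM mulrACA.
pose wm := isMultiplicative.Build (units K) (units L) w wM.
pose W : {multiplicative units K -> units L} := HB.pack w wm.
exists W, kappa; split=> //.
  apply: (@sub_finite_set _ _ (\bigcup_(t in [set` M])
      [set u : units L | val u = t])).
    move=> _ [u _ <-]; have [t tM e] := kappaM (val u) (valP u).
    exists t => //=; rewrite e unit_ext_val mulfK //; exact: (valP (rho u)).
  apply: bigcup_finite => // t _.
  have [[u <-]|nu'] := pselect (exists u : units L, val u = t).
    rewrite (_ : mkset _ = [set u]) //.
    by apply/seteqP; split=> v /= => [/val_inj|->].
  rewrite (_ : mkset _ = set0) //; apply/seteqP; split=> // v /= vt.
  by apply: nu'; exists v.
move=> x; rewrite /twist; case: insubP => [u x0 <-|].
  by rewrite /= divfK //; exact: (valP (rho u)).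
by rewrite negbK => /eqP ->; rewrite rmorph0.
Qed.

End coupling_isomorphism.

(** * Compactness, and averages of graph measures *)

Section compact_dual.
Variable R : realType.

Lemma ultra_fmap (T U : Type) (f : T -> U) (F : set_system T) :
  UltraFilter F -> UltraFilter (f @ F).
Proof.
move=> FU; split=> [|G GP FG]; first exact: fmap_proper_filter.
apply/seteqP; split=> // A GA.
have [//|FnA] := in_ultra_setVsetC (f @^-1` A) FU.
have GnA : G (~` A) by apply: FG.
have : G set0 by rewrite -(setICr A); exact: filterI.
by move=> G0; case: (@filter_not_empty _ G GP G0).
Qed.

Lemma ultra_bounded_cvg (T : Type) (F : set_system T) (f : T -> R) :
  UltraFilter F -> (forall x, `|f x| <= 1) -> exists a : R, f @ F --> a.
Proof.
move=> FU f1; have cpt := @segment_compact R (-1) 1.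
rewrite compact_ultra in cpt.
have [|a [_ fa]] := cpt (f @ F) (ultra_fmap f FU); last by exists a.
by apply: (@filterE _ F) => x; rewrite /= in_itv /= -ler_norml.
Qed.

Lemma cvg_Re_Im (T : Type) (F : set_system T) (f : T -> R[i]) (a b : R) :
  Filter F -> complex.Re (f x) @[x --> F] --> a ->
  complex.Im (f x) @[x --> F] --> b ->
  (f x : R[i]^o) @[x --> F] --> (Complex a b : R[i]^o).
Proof.
move=> FF fa fb A [e /= e0 eA].
have [r er] : exists r : R, e = r%:C%C by apply/complex_realP; exact: gtr0_real.
have r0 : 0 < r by rewrite -ltcR -er.
have r2 : 0 < r / 2 by rewrite divr_gt0.
have Fa : \forall x \near F, `|a - complex.Re (f x)| < r / 2.
  by move/cvgrPdist_lt : fa; exact.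
have Fb : \forall x \near F, `|b - complex.Im (f x)| < r / 2.
  by move/cvgrPdist_lt : fb; exact.
suff : F (f @^-1` A) by [].
near=> x; apply: eA; rewrite /= er normc_lt_Re_Im r0 Re_subc Im_subc /=.
have ha : `|a - complex.Re (f x)| < r / 2 by near: x.
have hb : `|b - complex.Im (f x)| < r / 2 by near: x.
rewrite -(real_normK (num_real (a - _))) -(real_normK (num_real (b - _))).
have := normr_ge0 (a - complex.Re (f x)).
have := normr_ge0 (b - complex.Im (f x)).
nra.
Unshelve. all: by end_near. Qed.

(** Along an ultrafilter the values of the characters converge pointwise, and
    the limit is again a character. *)
Lemma dual_compact (V : zmodType) : compact [set: dual R V].
Proof.
rewrite compact_ultra => F FU _.
have FF : ProperFilter F by exact: ultra_proper.
have /choice[a aP] : forall v, exists a : R, dcos xi v @[xi --> F] --> a.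
  by move=> v; apply: ultra_bounded_cvg => xi; exact: dcos_le1.
have /choice[b bP] : forall v, exists b : R, dsin xi v @[xi --> F] --> b.
  by move=> v; apply: ultra_bounded_cvg => xi; exact: dsin_le1.
pose z v := Complex (a v) (b v).
have z1 v : `|z v| = 1.
  rewrite normc_def /=; suff -> : a v ^+ 2 + b v ^+ 2 = 1 by rewrite sqrtr1.
  have h : dcos xi v * dcos xi v + dsin xi v * dsin xi v @[xi --> F] -->
      a v * a v + b v * b v.
    by apply: cvgD; apply: cvgM; (exact: aP || exact: bP).
  rewrite !expr2; apply: (cvg_unique _ h) => //.
  rewrite (_ : (fun xi => _) = fun=> 1); first exact: cvg_cst.
  by apply/funext => xi; rewrite -!expr2 dcos2Ddsin2.
have zD v w : z (v + w) = z v * z w.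
  congr Complex.
    apply: (cvg_unique _ (aP (v + w))) => //.
    rewrite (_ : (fun xi => _) = fun xi : dual R V =>
      dcos xi v * dcos xi w - dsin xi v * dsin xi w); last first.
      by apply/funext => xi; exact: dcosD.
    by apply: cvgB; apply: cvgM; (exact: aP || exact: bP).
  apply: (cvg_unique _ (bP (v + w))) => //.
  rewrite (_ : (fun xi => _) = fun xi : dual R V =>
    dcos xi v * dsin xi w + dsin xi v * dcos xi w); last first.
    by apply/funext => xi; exact: dsinD.
  by apply: cvgD; apply: cvgM; (exact: aP || exact: bP).
exists (Dual z1 zD); split=> //; apply/cvg_dual => v /=.
exact: cvg_Re_Im (aP v) (bP v).
Qed.

Lemma continuous_bounded_measurable (K L : zmodType)
    (cK : countable [set: K]) (cL : countable [set: L])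
    (f : dual R K * dual R L -> R) :
  continuous f -> bounded_measurable f.
Proof.
move=> cf; split.
  apply: (measurability (@RGenOInfty.G R)).
    exact: RGenOInfty.measurableE.
  move=> _ [_ [a ->] <-]; rewrite setTI measurable_dual_prod //.
  apply: sub_sigma_algebra; apply: open_comp; first by move=> x _; exact: cf.
  exact: interval_open.
have cX : compact [set: dual R K * dual R L].
  by rewrite -setXTT; apply: compact_setX; exact: dual_compact.
have := @continuous_compact _ _ f setT (continuous_subspaceT cf) cX.
move=> /(@compact_bounded R R^o) [M [_ Mf]].
exists (M + 1) => x; apply: (Mf (M + 1)); first by rewrite ltrDl.
by exists x.
Qed.

End compact_dual.

Section average.
Context d1 d2 (Y : measurableType d1) (X : measurableType d2) (R : realType).
Variables (m : probability Y R) (I : Type) (g : I -> Y -> X).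
Hypothesis mg : forall i, measurable_fun setT (g i).

Lemma average_probability (i0 : I) (s : seq I) : (0 < size s)%N ->
  exists mu : probability X R, forall f, bounded_measurable f ->
    \int[mu]_x f x = (size s)%:R^-1 * \sum_(i <- s) \int[m]_y f (g i y).
Proof.
move=> s0; have n0 : 0 <= (size s)%:R^-1 :> R by rewrite invr_ge0.
have nn : (size s)%:R != 0 :> R by rewrite pnatr_eq0 -lt0n.
pose m_ k : {measure set X -> \bar R} :=
  measure_function_pushforward__canonical__measure_function_Measure
    m (mg (nth i0 s k)).
pose M : {measure set X -> \bar R} := mscale (NngNum n0) (msum m_ (size s)).
have MT : M setT = 1%E.
  rewrite /M /= /mscale.
  rewrite [X in (_ * X)%E](_ : _ = (\sum_(k < size s) (1 : R)%:E)%E); last first.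
    apply: eq_bigr => k _; rewrite /= /pushforward preimage_setT.
    exact: probability_setT.
  by rewrite sumEFin sumr_const card_ord -EFinM mulVf.
pose Mp := Measure_isProbability.Build _ _ _ M MT.
pose mu : probability X R := HB.pack (M : set X -> \bar R) M Mp.
exists mu => f bf; have [mf [B fB]] := bf.
(* Adding the bound of [f] reduces to integrals of nonnegative functions. *)
have B0 x : 0 <= f x + B.
  by have := fB x; rewrite ler_norml => /andP[]; lra.
have bfB : bounded_measurable (fun x => f x + B) by exact/bmD/bm_cst.
have bfBg i : bounded_measurable (fun y => f (g i y) + B).
  exact: (bm_comp (mg i) bfB).
have eB : \int[mu]_x (f x + B) = \int[mu]_x f x + B.
  rewrite bm_RintegralD //; last exact: bm_cst.
  by rewrite Rintegral_cst // [X in fine X](probability_setT mu) mulr1.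
have eBg i : \int[m]_y (f (g i y) + B) = \int[m]_y f (g i y) + B.
  rewrite bm_RintegralD //; [|exact: (bm_comp (mg i) bf)|exact: bm_cst].
  by rewrite Rintegral_cst // [X in fine X](probability_setT m) mulr1.
apply: (@addIr _ B); rewrite -eB.
have mfB : measurable_fun setT (fun x => (f x + B)%:E).
  by apply/measurable_EFinP; exact: bfB.1.
rewrite /Rintegral [X in fine X](_ : _ =
    ((size s)%:R^-1 * \sum_(i <- s) (\int[m]_y f (g i y) + B))%:E).
  rewrite /= big_split /= mulrDr; congr (_ + _).
  by rewrite big_const_seq count_predT iter_addr addr0 -[B *+ _]mulr_natl mulKf.
rewrite (_ : (\int[mu]_x _)%E = (\int[M]_x (f x + B)%:E)%E) //.
rewrite ge0_integral_mscale //; last by move=> x _; rewrite lee_fin.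
rewrite ge0_integral_measure_sum //; last by move=> x _; rewrite lee_fin.
rewrite EFinM; congr (_ * _)%E.
rewrite (big_nth i0) big_mkord -sumEFin; apply: eq_bigr => k _.
rewrite -eBg /m_ /= ge0_integral_pushforward //; last first.
  by move=> x _; rewrite lee_fin.
rewrite preimage_setT /Rintegral fineK //.
exact: (integrable_fin_num _ (bm_integrable m measurableT (bfBg _))).
Qed.

End average.

(** * Trivial characters on a line *)

Section line.
Variables (R : realType) (K L : fieldType) (kappa : {rmorphism K -> L}).
Implicit Types (v : K * L) (xi : dual R (K * L)%type) (a b : K).

(** [K * L] as a vector space over [K], through [kappa]. *)
Definition gscale a v : K * L := (a * v.1, kappa a * v.2).

Lemma gscaleDl a b v : gscale (a + b) v = gscale a v + gscale b v.
Proof. by rewrite /gscale rmorphD !mulrDl. Qed.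

Lemma gscaleNl a v : gscale (- a) v = - gscale a v.
Proof. by rewrite /gscale rmorphN !mulNr. Qed.

Lemma gscaleBl a b v : gscale (a - b) v = gscale a v - gscale b v.
Proof. by rewrite gscaleDl gscaleNl. Qed.

Lemma gscale0l v : gscale 0 v = 0.
Proof. by rewrite /gscale rmorph0 !mul0r. Qed.

Lemma gscale1l v : gscale 1 v = v.
Proof. by rewrite /gscale rmorph1 !mul1r -surjective_pairing. Qed.

Lemma gscaleA a b v : gscale a (gscale b v) = gscale (a * b) v.
Proof. by rewrite /gscale /= rmorphM !mulrA. Qed.

Lemma gscaleDr a v v' : gscale a (v + v') = gscale a v + gscale a v'.
Proof. by rewrite /gscale /= !mulrDr. Qed.

Definition trivial_on_line v : set (dual R (K * L)%type) :=
  [set xi | forall a, xi (gscale a v) = 1].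

Definition dcos_average (l : seq K) v xi : R :=
  (size l)%:R^-1 * \sum_(a <- l) dcos xi (gscale a v).

(** The product of two cosines is half the sum of the cosines of the sum and of
    the difference. *)
Lemma dcos_averageM (l l' : seq K) : l != [::] -> l' != [::] ->
  exists2 l'', l'' != [::] & forall v xi,
    dcos_average l'' v xi = dcos_average l v xi * dcos_average l' v xi.
Proof.
move=> l0 l'0.
have nz (s : seq K) : s != [::] -> (size s)%:R != 0 :> R.
  by rewrite pnatr_eq0 -size_eq0.
exists ([seq a + b | a <- l, b <- l'] ++ [seq a - b | a <- l, b <- l']).
  by rewrite -size_eq0 size_cat !size_allpairs addn_eq0 muln_eq0 !size_eq0
    (negbTE l0) (negbTE l'0).
move=> v xi; rewrite /dcos_average size_cat !size_allpairs big_cat.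
rewrite !big_allpairs_dep [RHS]mulrACA big_distrlr /=.
rewrite (_ : _ + _ = 2 * \sum_(a <- l) \sum_(b <- l')
    dcos xi (gscale a v) * dcos xi (gscale b v)); last first.
  rewrite mulr_sumr -big_split; apply: eq_bigr => a _ /=.
  rewrite mulr_sumr -big_split; apply: eq_bigr => b _ /=.
  by rewrite gscaleBl gscaleDl dcosB dcosD; ring.
by rewrite addnn -muln2 !natrM; field; rewrite !nz.
Qed.

Lemma dcos_averageX (l : seq K) n : l != [::] ->
  exists2 l', l' != [::] & forall v xi,
    dcos_average l' v xi = dcos_average l v xi ^+ n.
Proof.
move=> l0; elim: n => [|n [l' l'0 IH]].
  exists [:: 0] => // v xi.
  by rewrite /dcos_average big_seq1 gscale0l dcos0 /= invr1 mulr1.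
have [l'' l''0 e] := dcos_averageM l0 l'0.
by exists l'' => // v xi; rewrite e IH exprS.
Qed.

(** The factor of [e j] is at most [1], with equality if and only if [xi] is
    trivial at [gscale (e j) v]; each is used arbitrarily often. *)
Definition line_product (e : nat -> K) (k : nat) v xi : R :=
  \prod_(j < k) ((1 + dcos xi (gscale (e j) v)) / 2) ^+ k.

Lemma line_product_average e k : exists2 l, l != [::] & forall v xi,
  dcos_average l v xi = line_product e k v xi.
Proof.
suff H n : exists2 l, l != [::] & forall v xi, dcos_average l v xi =
    \prod_(j < n) ((1 + dcos xi (gscale (e j) v)) / 2) ^+ k by exact: H.
elim: n => [|n [l l0 IH]].
  exists [:: 0] => // v xi.
  by rewrite /dcos_average big_seq1 gscale0l dcos0 big_ord0 /= invr1 mulr1.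
have [l' l'0 e'] := @dcos_averageX [:: 0; e n] k isT.
have [l'' l''0 e''] := dcos_averageM l0 l'0.
exists l'' => // v xi; rewrite e'' IH e' big_ord_recr; congr (_ * _ ^+ _).
by rewrite /dcos_average big_cons big_seq1 gscale0l dcos0 mulrC.
Qed.

Lemma line_factor_ge0 a v xi : 0 <= (1 + dcos xi (gscale a v)) / 2 <= 1.
Proof.
have := dcos_le1 xi (gscale a v); rewrite ler_norml => /andP[h1 h2].
by apply/andP; split; lra.
Qed.

Lemma line_product_ge0 e k v xi : 0 <= line_product e k v xi <= 1.
Proof.
rewrite /line_product; apply/andP; split.
  apply: prodr_ge0 => j _; apply: exprn_ge0.
  by have /andP[] := line_factor_ge0 (e j) v xi.
apply: prodr_ile1 => j _; have /andP[h0 h1] := line_factor_ge0 (e j) v xi.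
by rewrite exprn_ge0 // exprn_ile1.
Qed.

Lemma line_product_cvg0 (e : nat -> K) v xi : (forall a, exists j, e j = a) ->
  ~ trivial_on_line v xi -> line_product e k v xi @[k --> \oo] --> (0 : R).
Proof.
move=> e_surj ntriv.
have [a xia] : exists a, xi (gscale a v) != 1.
  apply: contrapT => h; apply: ntriv => a.
  by apply/eqP/negPn/negP => xia; apply: h; exists a.
have [j ej] := e_surj a.
set q := (1 + dcos xi (gscale (e j) v)) / 2.
have /andP[q0 q1] : 0 <= q <= 1 by exact: line_factor_ge0.
have q1' : q < 1.
  rewrite lt_neqAle q1 andbT; apply/eqP => qe.
  move: xia; rewrite -ej -dcos_eq1 => /eqP; apply.
  by move: qe; rewrite /q => qe; lra.
apply: (@squeeze_cvgr _ _ _ _ (fun=> 0) (fun k => q ^+ k)).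
- near=> k; have /andP[-> /= _] := line_product_ge0 e k v xi.
  have jk : (j < k)%N by near: k; exact: nbhs_infty_gt.
  rewrite /line_product (bigD1 (Ordinal jk)) //= -/q ler_piMr ?exprn_ge0 //.
  apply: prodr_ile1 => i _; have /andP[h0 h1] := line_factor_ge0 (e i) v xi.
  by rewrite exprn_ge0 // exprn_ile1.
- exact: cvg_cst.
- by apply: cvg_expr; rewrite ger0_norm.
Unshelve. all: by end_near. Qed.

End line.

(** * Fourier coefficients of invariant couplings *)

Section multiplicative_groups.
Variables (G H : groupType) (f : {multiplicative G -> H}).

Lemma multiplicative1 : f 1%g = 1%g.
Proof. by apply: (@mulgI _ (f 1%g)); rewrite -gmulfM !mulg1. Qed.

Lemma multiplicativeV x : f x^-1%g = (f x)^-1%g.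
Proof. by apply: (@mulgI _ (f x)); rewrite -gmulfM !mulgV multiplicative1. Qed.

End multiplicative_groups.

Section twisted_coupling.
Variables (R : realType) (K L : fieldType).
Hypothesis cK : countable [set: K].
Hypothesis infK : infinite_set [set: K].
Variables (rho w : {multiplicative units K -> units L})
  (kappa : {rmorphism K -> L}).
Hypothesis w_fin : finite_set (range w).
Hypothesis kappaE : kappa =1 twist w rho.
Variable nu : probability (dual R K * dual R L)%type R.
Hypothesis nu_inv : invariant_measure (diag_act rho) nu.

Let X := (dual R K * dual R L)%type.
Let J : X -> dual R (K * L)%type := @pair_dual R K L.
Let gsc := gscale kappa.

Lemma kappa_units (u : units K) : kappa (val u) = val (w u) * val (rho u).
Proof. by rewrite kappaE /twist valK. Qed.

Lemma pair_dual_act u (p : X) v :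
  J (diag_act rho u p) v = J p (gsc (val u) (v.1, (val (w u))^-1 * v.2)).
Proof.
have e : kappa (val u) * ((val (w u))^-1 * v.2) = val (rho u) * v.2.
  rewrite kappa_units; move: (valP (w u)); move: (val (w u)) => a a0.
  by rewrite mulrACA mulfV ?mul1r.
rewrite -[RHS]/(p.1 (val u * v.1) *
  p.2 (kappa (val u) * ((val (w u))^-1 * v.2))).
by rewrite e.
Qed.

Lemma pair_dual_act_ker u (p : X) v : w u = 1%g ->
  J (diag_act rho u p) v = J p (gsc (val u) v).
Proof.
by move=> wu; rewrite pair_dual_act wu invr1 mul1r -surjective_pairing.
Qed.

Definition line_set (v : K * L) : set X := J @^-1` trivial_on_line kappa v.

Lemma measurable_line_set v : measurable (line_set v).
Proof.
rewrite -[line_set v]setCK; apply: measurableC.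
rewrite (_ : ~` _ = \bigcup_(a : K) [set p | dcos (J p) (gsc a v) != 1]).
  apply: countable_bigcupT_measurable => // a.
  rewrite (_ : mkset _ = (fun p => dcos (J p) (gsc a v)) @^-1` (~` [set 1])).
    rewrite -[X in measurable X]setTI.
    by apply: (bm_dcos_pair R (gsc a v)).1 => //; exact: measurableC.
  by apply/seteqP; split=> p /= /eqP.
apply/seteqP; split=> p /=.
  move=> h; apply: contrapT => h'; apply: h => a; apply/eqP.
  by rewrite -dcos_eq1; apply/negPn/negP => ha; apply: h'; exists a.
by move=> [a _ /= +] h; rewrite dcos_eq1 h eqxx.
Qed.

Lemma line_set_scale a v : a != 0 -> line_set (gsc a v) = line_set v.
Proof.
move=> a0; apply/seteqP; split=> p h b.
  by have := h (b / a); rewrite /gsc gscaleA divfK.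
by rewrite /gsc gscaleA; exact: h.
Qed.

Lemma line_set_act u v : diag_act rho u @^-1` line_set v =
  line_set (v.1, (val (w u))^-1 * v.2).
Proof.
have u0 : val u != 0 by exact: (valP u).
have k0 : kappa (val u) != 0 by rewrite fmorph_eq0.
apply/seteqP; split=> p h b.
  have hb : J (diag_act rho u p) (gsc (b / val u) v) = 1 := h (b / val u).
  rewrite pair_dual_act in hb; apply: etrans hb; congr (J p _).
  rewrite /gsc /gscale /fst /snd.
  have w0 : val (w u) != 0 := valP (w u).
  by rewrite rmorphM fmorphV; congr pair; field; rewrite ?w0 ?k0.
have <- : J p (gsc (b * val u) (v.1, (val (w u))^-1 * v.2)) = 1 := h (b * val u).
rewrite -[LHS]/(J (diag_act rho u p) (gsc b v)) pair_dual_act; congr (J p _).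
rewrite /gsc /gscale /fst /snd.
by rewrite rmorphM; congr pair; ring.
Qed.

Lemma line_set_act_ker u v : w u = 1%g ->
  diag_act rho u @^-1` line_set v = line_set v.
Proof.
by move=> wu; rewrite line_set_act wu invr1 mul1r -surjective_pairing.
Qed.

Let w_ext (a : K) : units L := if insub a is Some u then w u else 1%g.

Let in_ker (a : K) := exists2 u : units K, val u = a & w u = 1%g.

Let w_ext_ker a b : a != 0 -> b != 0 -> w_ext a = w_ext b -> in_ker (a / b).
Proof.
move=> a0 b0; pose u : units K := exist _ a a0; pose u' : units K := exist _ b b0.
rewrite /w_ext -[a]/(val u) -[b]/(val u') !valK => e.
exists (u * u'^-1)%g => //.
by rewrite gmulfM multiplicativeV e mulgV.
Qed.

(** For generic [x] and [y] the value of [w] at [x - y] is constant; dividing by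
    one such difference [t] lands in the kernel of [w]. *)
Lemma differences_in_coset n : exists (x0 t : K) (s : seq K),
  [/\ size s = n, uniq s, forall x, x \in s -> in_ker ((x0 - x) / t) &
   forall x y, x \in s -> y \in s -> x != y ->
     in_ker ((x - y) / t) \/ in_ker ((y - x) / t)].
Proof.
have [U UU U_cof] := nonprincipal_ultra infK.
pose W : seq (units L) := 1%g :: fset_set (range w).
have w_extW a : w_ext a \in W.
  rewrite /w_ext; case: insubP => [u _ _|_]; last exact: mem_head.
  by rewrite inE; apply/orP; right; rewrite in_fset_set // inE; exists u.
have /choice[c cP] : forall x, exists c, c \in W /\
    \forall y \near U, w_ext (x - y) = c.
  move=> x; have [|c cW Uc] := @ultra_finite_range K _ U UU (fun y => w_ext (x - y)) W.
    exact: nearW.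
  by exists c.
have [|r rW Ur] := @ultra_finite_range K _ U UU c W.
  by apply: nearW => x; have [] := cP x.
have Uq : \forall x \near U, \forall y \near U,
    (x != y) && (w_ext (x - y) == r).
  near=> x; have [_ Ux] := cP x; near=> y; apply/andP; split.
    by rewrite eq_sym; near: y; exact: ultra_neq.
  have <- : c x = r by near: x.
  by apply/eqP; near: y.
have U1 : \forall x \near U, (predT : pred K) x by exact: nearW.
have [s' [ss' us' _ ps']] := ultra_pairwise UU U_cof n.+2 U1 Uq.
case: s' ss' us' ps' => [//|x0 [//|x1 s]] [ss] /= /and3P[x0s x1s us].
move=> /andP[/andP[x01 sx0] /andP[sx1 sp]].
have {x01}[x01 wx01] := andP x01.
have t0 : x0 - x1 != 0 by rewrite subr_eq0.
exists x0, (x0 - x1), s; split=> //.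
  move=> x xs; have /andP[x0x /eqP e] := allP sx0 x xs.
  by apply: w_ext_ker; rewrite ?subr_eq0 // e (eqP wx01).
have key x y : (x != y) && (w_ext (x - y) == r) -> in_ker ((x - y) / (x0 - x1)).
  move=> /andP[xy /eqP e].
  by apply: w_ext_ker; rewrite ?subr_eq0 // e (eqP wx01).
elim: s sp {ss x0s x1s us sx0 sx1} => [//|z s IH] /= /andP[zs sp] x y.
rewrite !inE => /orP[/eqP->|xs] /orP[/eqP->|ys] xy.
- by rewrite eqxx in xy.
- by left; apply: key; exact: (allP zs).
- by right; apply: key; exact: (allP zs).
- exact: IH.
Unshelve. all: by end_near. Qed.

Section complement.
Variable v : K * L.
Let E := ~` line_set v.
Let mE : measurable E. Proof. by apply: measurableC; exact: measurable_line_set. Qed.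
Let c u := \int[nu]_(p in E) dcos (J p) u.
Let s u := \int[nu]_(p in E) dsin (J p) u.

Let bmc := @bm_dcos_pair R K L.
Let bms := @bm_dsin_pair R K L.

Let c_inv a u : in_ker a -> c (gsc a u) = c u /\ s (gsc a u) = s u.
Proof.
move=> [k <- wk]; have mk := measurable_diag_act (R := R) rho k.
have EE : diag_act rho k @^-1` E = E.
  by rewrite /E -preimage_setC line_set_act_ker.
have cE := bm_Rintegral_comp mk (nu_inv k) mE (bmc u).
have sE := bm_Rintegral_comp mk (nu_inv k) mE (bms u).
rewrite EE in cE sE; split; rewrite /c /s.
  rewrite -cE; apply: eq_Rintegral => p _; rewrite /dcos.
  by rewrite -[pair_dual _]/(J _) pair_dual_act_ker.
rewrite -sE; apply: eq_Rintegral => p _; rewrite /dsin.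
by rewrite -[pair_dual _]/(J _) pair_dual_act_ker.
Qed.

Let cN u : c (- u) = c u.
Proof. by apply: eq_Rintegral => p _; rewrite dcosN. Qed.

Let c0 : c 0 = fine (nu E).
Proof.
rewrite /c (@eq_Rintegral _ _ _ _ _ (fun=> 1)); last first.
  by move=> p _; rewrite dcos0.
by rewrite Rintegral_cst // mul1r.
Qed.

Let c0_le1 : c 0 <= 1. Proof. by rewrite c0 fine_probability_le1. Qed.

Let c_le u : c u <= c 0.
Proof.
apply: bm_le_Rintegral => // p _.
by rewrite dcos0; exact: le_trans (ler_norm _) (dcos_le1 _ _).
Qed.

(** Every off-diagonal term equals [c u], by invariance under the kernel of
    [w]. *)
Let double_sum n (l : seq K) (t : K) u : size l = n -> uniq l ->
  (forall x y, x \in l -> y \in l -> x != y ->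
     in_ker ((x - y) / t) \/ in_ker ((y - x) / t)) ->
  \sum_(a <- [seq gsc (x / t) u | x <- l])
    \sum_(b <- [seq gsc (x / t) u | x <- l]) c (a - b) =
  n%:R * (c 0 - c u) + n%:R * n%:R * c u.
Proof.
move=> sl ul lP; rewrite big_map.
under eq_bigr do rewrite big_map.
rewrite (_ : n%:R * _ + _ = \sum_(x <- l) ((c 0 - c u) + n%:R * c u)); last first.
  rewrite big_const_seq count_predT iter_addr addr0 sl -[RHS]mulr_natl.
  by ring.
rewrite big_seq [RHS]big_seq; apply: eq_bigr => x xl.
rewrite (bigD1_seq x) //= subrr.
rewrite (_ : n%:R * c u = \sum_(y <- l) c u); last first.
  by rewrite big_const_seq count_predT iter_addr addr0 sl -[RHS]mulr_natl.
rewrite [in RHS](bigD1_seq x) //= addrA subrK; congr (_ + _).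
rewrite big_seq_cond [RHS]big_seq_cond; apply: eq_bigr => y /andP[yl yx].
rewrite -[gsc _ u - _]/(gscale kappa _ u - _) -gscaleBl -mulrBl.
rewrite eq_sym in yx; have [h|h] := lP x y xl yl yx.
  by have [e _] := c_inv u h; exact: e.
by have [e _] := c_inv u h; rewrite -opprB mulNr gscaleNl cN; exact: e.
Qed.

(** Otherwise the double sum, which dominates a square, would become negative
    for large [n]. *)
Let c_ge0 u : 0 <= c u.
Proof.
rewrite leNgt; apply/negP => cu.
pose n := (Num.bound (- (c u))^-1).+2.
have [x0 [t [l [sl ul _ lP]]]] := differences_in_coset n.
have [+ _] := fourier_positive nu mE bmc bms [seq gsc (x / t) u | x <- l] 0.
rewrite (double_sum u sl ul lP) => /(le_trans (sqr_ge0 _)).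
have n0 : 0 < n%:R :> R by rewrite ltr0n.
rewrite -mulrA -mulrDr pmulr_rge0 //.
have h : (- c u)^-1 < n%:R - 1.
  rewrite /n -natr1 addrK (lt_le_trans (archi_boundP _)) ?ler_nat //.
  by rewrite invr_ge0 oppr_ge0 ltW.
have : 1 < (n%:R - 1) * - c u.
  by rewrite -ltr_pdivrMr ?oppr_gt0 // div1r.
move: c0_le1; nra.
Qed.

(** The averages over the lists of [line_product_average] tend to zero, along
    any [gsc b v] with [b != 0]. Finitely many such [b] suffice to multiply
    every nonzero scalar into the kernel of [w]; so the sum of the corresponding
    averages is at least [c v]. *)
Let c_eq0 : c v = 0.
Proof.
apply/eqP; rewrite eq_le c_ge0 andbT.
have [f finj] : exists f : K -> nat, injective f.
  by have /countable_injP[f fi] := cK; exists f => x y; apply: fi; rewrite in_setT.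
have /choice[e eP] : forall n, exists a : K, forall b, f b = n -> a = b.
  move=> n; have [[b fb]|h] := pselect (exists b, f b = n).
    by exists b => b' fb'; apply: finj; rewrite fb fb'.
  by exists 0 => b fb; exfalso; apply: h; exists b.
have e_surj a : exists j, e j = a by exists (f a); exact: eP.
have /choice[l lP] : forall k, exists l, l != [::] /\ forall u (xi : dual R (K * L)%type),
    dcos_average kappa l u xi = line_product kappa e k u xi.
  by move=> k; have [l l0 h] := line_product_average R kappa e k; exists l.
pose avg k u := (size (l k))%:R^-1 * \sum_(a <- l k) c (gsc a u).
have avg_cvg b : b != 0 -> avg k (gsc b v) @[k --> \oo] --> (0 : R).
  move=> b0; rewrite (_ : (fun k => _) = fun k =>
      \int[nu]_(p in E) line_product kappa e k (gsc b v) (J p)); last first.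
    apply/funext => k; have [_ h] := lP k.
    under [RHS]eq_Rintegral do rewrite -h.
    rewrite bm_RintegralZ //; last by apply: bm_sum => a; exact: bmc.
    by rewrite bm_Rintegral_sum // => a; exact: bmc.
  rewrite (_ : 0 = \int[nu]_(p in E) (0 : R)); last by rewrite Rintegral_cst // mul0r.
  apply: (@bm_dominated _ _ _ _ _ _ _ 1) => //.
  - move=> k; have [_ h] := lP k; under eq_fun do rewrite -h.
    by apply: (bmZ _ _).1; apply: bm_sum => a; exact: bmc.
  - move=> k p; have /andP[h0 h1] := line_product_ge0 kappa e k (gsc b v) (J p).
    by rewrite ger0_norm.
  - move=> p Ep; apply: line_product_cvg0 => //.
    by rewrite -[trivial_on_line _ _ _]/(line_set (gsc b v) p) line_set_scale.
pose W := fset_set (range w).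
have /choice[t tP] : forall r, exists t : units K, r \in W -> w t = r.
  move=> r; have [|] := boolP (r \in W); last by exists 1%g.
  by rewrite in_fset_set // inE => -[t _ <-]; exists t.
have tot_cvg : \sum_(r <- W) avg k (gsc (val (t r))^-1 v) @[k --> \oo] --> (0 : R).
  elim: (W : seq _) => [|r W' IH].
    by under eq_fun do rewrite big_nil; exact: cvg_cst.
  have tr0 : (val (t r))^-1 != 0 by rewrite invr_eq0; exact: (valP (t r)).
  under eq_fun do rewrite big_cons.
  by have := cvgD (avg_cvg _ tr0) IH; rewrite addr0; exact.
have uW : uniq W by exact: fset_uniq.
have W1 : 1%g \in W.
  by rewrite in_fset_set // inE; exists 1%g => //; exact: multiplicative1.
have tot_ge k : c v <= \sum_(r <- W) avg k (gsc (val (t r))^-1 v).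
  have [l0 _] := lP k.
  have n0 : 0 < (size (l k))%:R :> R by rewrite ltr0n lt0n size_eq0.
  rewrite /avg -mulr_sumr exchange_big /=.
  rewrite -(ler_pM2l n0) mulVKf ?gt_eqF //.
  rewrite mulr_natl -[leLHS]addr0 -iter_addr -[size _]count_predT -big_const_seq.
  apply: ler_sum => a _.
  have pos r : 0 <= c (gsc a (gsc (val (t r))^-1 v)) by exact: c_ge0.
  have [->|a0] := eqVneq a 0.
    rewrite (bigD1_seq 1%g) //= -[leLHS]addr0; apply: lerD; last first.
      by apply: sumr_ge0 => r _; exact: c_ge0.
    by rewrite /gsc gscale0l c_le.
  pose u : units K := exist _ a a0.
  have wuW : w u \in W by rewrite in_fset_set // inE; exists u.
  rewrite (bigD1_seq (w u)) //= -[leLHS]addr0; apply: lerD; last exact: sumr_ge0.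
  rewrite /gsc gscaleA -/(gsc _ _).
  have [|-> //] := @c_inv (a * (val (t (w u)))^-1) v.
  exists (u * (t (w u))^-1)%g => //.
  by rewrite gmulfM multiplicativeV tP // mulgV.
rewrite -(cvg_lim _ tot_cvg) //; apply: limr_ge; first exact: (cvgP _ tot_cvg).
exact: nearW.
Qed.

(** As the real parts vanish, the double sum only grows linearly in [n], whereas
    the square that it dominates is [(n * s v) ^+ 2]. *)
Let s_eq0 : s v = 0.
Proof.
apply/eqP/negPn/negP => s0.
have s2 : 0 < s v ^+ 2 by rewrite exprn_even_gt0.
pose n := (Num.bound (s v ^+ 2)^-1).+1.
have [x0 [t [l [sl ul l0 lP]]]] := differences_in_coset n.
have [_] := fourier_positive nu mE bmc bms [seq gsc (x / t) v | x <- l]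
  (- gsc (x0 / t) v).
rewrite (double_sum v sl ul lP) c_eq0 mulr0 addr0 subr0 big_map.
have -> : \sum_(x <- l) \int[nu]_(p in E)
    dsin (pair_dual p) (- gsc (x0 / t) v + gsc (x / t) v) = n%:R * - s v.
  rewrite -sl mulr_natl -[RHS]addr0 -iter_addr -[size _]count_predT -big_const_seq.
  rewrite big_seq [RHS]big_seq; apply: eq_bigr => x xl.
  have [_ <-] := c_inv v (l0 x xl).
  rewrite -[RHS]mulN1r /s -bm_RintegralZ //; apply: eq_Rintegral => p _.
  by rewrite mulN1r -dsinN mulrBl /gsc gscaleBl opprB addrC.
have n0 : 0 < n%:R :> R by rewrite ltr0n.
rewrite exprMn sqrrN expr2 -mulrA ler_pM2l // => h.
have : (s v ^+ 2)^-1 < n%:R.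
  by rewrite (lt_le_trans (archi_boundP _)) ?ler_nat // invr_ge0 ltW.
rewrite -div1r ltr_pdivrMr // ltNge => /negP; apply.
exact: le_trans h c0_le1.
Qed.

(** Outside [line_set v] the real parts of the coefficients along the line of
    [v] are nonnegative and have averages tending to zero, which leaves only
    the part where the character is [1]. *)
Lemma coef_line_set :
  \int[nu]_p dcos (J p) v = fine (nu (line_set v)) /\
  \int[nu]_p dsin (J p) v = 0.
Proof.
have mA := measurable_line_set v.
have split_int (f : X -> R) : bounded_measurable f -> \int[nu]_p f p =
    \int[nu]_(p in line_set v) f p + \int[nu]_(p in E) f p.
  move=> bf; rewrite -(setUv (line_set v)) Rintegral_setU //.
    by apply: bm_integrable => //; exact: measurableU.
  by rewrite disj_set2E setICr.
have J1 p : line_set v p -> J p v = 1.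
  by move=> h; have := h 1; rewrite gscale1l.
split.
  rewrite split_int // -/(c v) c_eq0 addr0.
  rewrite (@eq_Rintegral _ _ _ _ _ (fun=> 1)).
    by rewrite Rintegral_cst // mul1r.
  by move=> p /set_mem /J1 e; rewrite /dcos e.
rewrite split_int // -/(s v) s_eq0 addr0.
rewrite (@eq_Rintegral _ _ _ _ _ (fun=> 0)).
  by rewrite Rintegral_cst // mul0r.
by move=> p /set_mem /J1 e; rewrite /dsin e.
Qed.

End complement.

End twisted_coupling.

(** * Ergodic couplings *)

Section ergodic_coupling.
Variables (R : realType) (K L : fieldType).
Hypotheses (cK : countable [set: K]) (cL : countable [set: L]).
Hypothesis infK : infinite_set [set: K].
Variables (mK : probability (dual R K) R) (mL : probability (dual R L) R).
Hypotheses (haarK : is_haar mK) (haarL : is_haar mL).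
Variables (rho w : {multiplicative units K -> units L})
  (kappa : {rmorphism K -> L}).
Hypothesis w_fin : finite_set (range w).
Hypothesis kappaE : kappa =1 twist w rho.
Hypothesis kappa_bij : bijective kappa.
Variable nu : probability (dual R K * dual R L)%type R.
Hypothesis nu_coupling : is_coupling mK mL nu.
Hypothesis nu_erg : ergodic_measure (diag_act rho) nu.
Hypothesis nu_nontrivial : ~ trivial_coupling mK mL nu.

Let X := (dual R K * dual R L)%type.
Let W := fset_set (range w).
Let n : R := (size W)%:R.
Let A := @line_set R K L kappa.
Let mA v : measurable (A v) := measurable_line_set cK kappa v.
Let nu_inv : invariant_measure (diag_act rho) nu := nu_erg.1.
Let coefA v := coef_line_set cK infK w_fin kappaE nu_inv v.
Let vanishing := nontrivial_coupling haarK haarL cK cL nu_coupling nu_nontrivial.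

Let mem_W c : (c \in W) = `[< range w c >].
Proof. by rewrite in_fset_set. Qed.

Let W1 : 1%g \in W.
Proof. by rewrite mem_W; apply/asboolP; exists 1%g => //; exact: multiplicative1. Qed.

Let n_gt0 : 0 < n.
Proof. by rewrite ltr0n cardfs_gt0; apply/fset0Pn; exists 1%g. Qed.

Let nuA0 v : fine (nu (A v)) = 0 -> nu (A v) = 0%E.
Proof. by move=> e; rewrite -[LHS]fineK ?e // fin_num_measure. Qed.

Let A_snd y : y != 0 -> nu (A (0, y)) = 0%E.
Proof.
move=> y0; apply: nuA0; have [<- _] := coefA (0, y).
rewrite (coupling_coef_snd y nu_coupling).1.
by have [_ _ /(_ y y0)[]] := vanishing.
Qed.

Let A_fst x : x != 0 -> nu (A (x, 0)) = 0%E.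
Proof.
move=> x0; apply: nuA0; have [<- _] := coefA (x, 0).
rewrite (coupling_coef_fst x nu_coupling).1.
by have [_ /(_ x x0)[]] := vanishing.
Qed.

Let A_sndE y : y != 0 -> A (0, y) = A (0, 1).
Proof.
move=> y0; have [g _ gK] := kappa_bij.
have -> : (0, y) = gscale kappa (g y) (0, 1).
  by rewrite /gscale /= mulr0 mulr1 gK.
by rewrite /A line_set_scale // -(fmorph_eq0 kappa) gK.
Qed.

Let A_fstE x y : x != 0 -> A (x, y) = A (1, y / kappa x).
Proof.
move=> x0; rewrite -[RHS](line_set_scale R kappa (1, y / kappa x) x0) /gscale /= mulr1.
by rewrite mulrC divfK // fmorph_eq0.
Qed.

(** [A (1, y)] is the graph of the map sending [eta] to the character
    [a |-> eta (- kappa a * y)]; without the points over the trivial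
    character [eta], distinct graphs are disjoint. *)
Let B y : set X := A (1, y) `\` A (0, 1).

Let mB y : measurable (B y). Proof. exact: measurableD. Qed.

Let nuB y : nu (B y) = nu (A (1, y)).
Proof.
rewrite (measureDI nu (mA (1, y)) (mA (0, 1))) [X in (_ + X)%E](_ : _ = 0%E) ?adde0 //.
apply/eqP; rewrite eq_le measure_ge0 andbT -(A_snd (oner_neq0 L)).
by apply: le_measure; rewrite ?inE //; exact: measurableI.
Qed.

Let B_disjoint y y' p : B y p -> B y' p -> y = y'.
Proof.
move=> [h hZ] [h' _]; apply/eqP/negPn/negP => yy'; apply: hZ.
rewrite -(A_sndE (_ : y - y' != 0)); last by rewrite subr_eq0.
move=> a; have e : gscale kappa a (1, y) =
    gscale kappa a (0, y - y') + gscale kappa a (1, y').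
  by rewrite -gscaleDr -[_ + _]/(0 + 1, y - y' + y') add0r subrK.
have := h a; rewrite e dual_add => <-.
by rewrite (h' a) mulr1.
Qed.

Let B_act u y : diag_act rho u @^-1` B y = B ((val (w u))^-1 * y).
Proof.
rewrite /B /A setDE preimage_setI -preimage_setC !(line_set_act R kappaE) /= -setDE.
rewrite mulr1; congr (_ `\` _); apply: A_sndE.
by rewrite invr_eq0; exact: (valP (w u)).
Qed.

Let D y : set X := \bigcup_(c in range w) B (val c * y).

Let mD y : measurable (D y).
Proof. by apply: fin_bigcup_measurable. Qed.

Let D_act u y : diag_act rho u @^-1` D y = D y.
Proof.
rewrite /D preimage_bigcup; apply/seteqP; split=> p.
  move=> [_ [k _ <-]]; rewrite B_act => h.
  exists (w (u^-1 * k)%g); first by exists (u^-1 * k)%g.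
  by rewrite gmulfM multiplicativeV /= -mulrA.
move=> [_ [k _ <-] h].
exists (w (u * k)%g); first by exists (u * k)%g.
rewrite B_act gmulfM /= mulrA mulKf //; exact: (valP (w u)).
Qed.

Let nuD y : y != 0 -> fine (nu (D y)) = n * fine (nu (A (1, y))).
Proof.
move=> y0; rewrite /D measure_fin_bigcup //; last first.
  move=> c c' _ _ [p [h h']]; have := B_disjoint h h'.
  by move=> /(mulIf y0) /val_inj.
rewrite fsbig_finite // (eq_big_seq (fun=> nu (B y))); last first.
  move=> c; rewrite mem_W => /asboolP[k _ <-].
  rewrite -(nu_inv k^-1%g (mB y)) B_act; congr (nu (B (_ * y))).
  by rewrite multiplicativeV /= invrK.
rewrite nuB -[nu _]fineK ?fin_num_measure // sumEFin /=.
by rewrite big_const_seq count_predT iter_addr addr0 -mulr_natl.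
Qed.

(** The union of the graphs of a coset of [range w] is invariant, hence null or
    conull; nontriviality makes one of them conull, and all its graphs have
    the same measure. *)
Lemma ergodic_graphs : exists2 y1 : L, y1 != 0 & forall y, y != 0 ->
  ((exists2 c, range w c & y = val c * y1) -> fine (nu (A (1, y))) = n^-1) /\
  (~ (exists2 c, range w c & y = val c * y1) -> fine (nu (A (1, y))) = 0).
Proof.
have [[x [y [x0 y0 xy0]]] _ _] := vanishing.
have kx0 : kappa x != 0 by rewrite fmorph_eq0.
have [cE sE] := coefA (x, y).
have nz : fine (nu (A (1, y / kappa x))) != 0.
  rewrite -A_fstE // -cE; case: xy0 => //; by rewrite sE eqxx.
set y1 := y / kappa x in nz.
have y10 : y1 != 0 by rewrite mulf_neq0 // invr_eq0.
have D1 : nu (D y1) = 1%E.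
  have [D0|//] := nu_erg.2 _ (mD y1) (fun u => D_act u y1).
  move: (nuD y10); rewrite D0 /= => /esym/eqP.
  by rewrite mulf_eq0 (negbTE nz) gt_eqF.
exists y1 => // y2 y20; split.
  move=> [_ [k _ <-] ->].
  have -> : nu (A (1, val (w k) * y1)) = nu (A (1, y1)).
    rewrite -!nuB -(nu_inv k^-1%g (mB y1)) B_act; congr (nu (B (_ * y1))).
    by rewrite multiplicativeV /= invrK.
  apply: (mulfI (lt0r_neq0 n_gt0)); rewrite -nuD // D1 mulfV //.
  exact: lt0r_neq0.
move=> ny2; rewrite -nuB.
have dis : D y1 `&` B y2 = set0.
  apply/seteqP; split=> // p [[c rc h] h2].
  by apply: ny2; exists c => //; exact: B_disjoint h2 h.
have := probability_le1 nu (measurableU _ _ (mD y1) (mB y2)).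
rewrite measureU // [X in (X + _)%E]D1 => h.
have : (1 + fine (nu (B y2)) <= 1)%R.
  by rewrite -lee_fin EFinD fineK ?fin_num_measure.
rewrite gerDl => h0; apply/eqP; rewrite eq_le h0 /=.
by rewrite fine_ge0.
Qed.

(** Both measures have the same Fourier coefficients once [b] is minus the
    inverse of a representative of the conull coset of graphs. *)
Lemma ergodic_coupling_form (mu : probability X R) :
  (forall f, bounded_measurable f -> \int[mu]_p f p = n^-1 *
     \sum_(c <- W) \int[mL]_eta f (dual_map kappa eta, dual_scale c eta)) ->
  exists b : units L, forall S : set X, measurable S ->
    nu S = pushforward mu (fun p => (p.1, dual_scale b p.2)) S.
Proof.
move=> muE; have [y1 y10 graphs] := ergodic_graphs.
have b0 : - y1^-1 != 0 by rewrite oppr_eq0 invr_eq0.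
pose b : units L := exist _ (- y1^-1) b0.
exists b; pose T (p : X) : X := (p.1, dual_scale b p.2).
have mT : measurable_fun setT T.
  apply: measurable_fun_pair; first exact: measurable_fst.
  exact: (measurableT_comp (measurable_dual_scale b) measurable_snd).
pose Tm : {mfun X >-> X} := HB.pack T (isMeasurableFun.Build _ _ _ _ T mT).
pose m2 : probability X R := distribution mu Tm.
have kappa_neq0 x : x != 0 -> kappa x != 0 by rewrite fmorph_eq0.
have haarE z : \int[mL]_eta dcos eta z = (z == 0)%:R /\
    \int[mL]_eta dsin eta z = 0.
  have [->|z0] := eqVneq z 0; last by have [_ _ /(_ z z0)] := vanishing.
  rewrite (@eq_Rintegral _ _ _ _ _ (fun=> 1)); last first.
    by move=> eta _; rewrite dcos0.
  rewrite (@eq_Rintegral _ _ _ mL _ (fun=> 0) (fun eta => dsin eta 0)); last first.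
    by move=> eta _; rewrite dsin0.
  rewrite !Rintegral_cst // [X in fine X](probability_setT mL) mulr1 mul0r.
  by [].
have graphE c eta v : pair_dual (T (dual_map kappa eta, dual_scale c eta)) v =
    eta (kappa v.1 + val c * (val b * v.2)).
  by rewrite dual_add.
have cosE v : \int[m2]_p dcos (pair_dual p) v =
    n^-1 * \sum_(c <- W) (kappa v.1 + val c * (val b * v.2) == 0)%:R.
  rewrite -(bm_Rintegral_comp mT (m1 := mu) (m2 := m2) (fun _ _ => erefl)
    measurableT (bm_dcos_pair R v)) preimage_setT muE; last first.
    exact: (bm_comp mT (bm_dcos_pair R v)).
  congr (_ * _); apply: eq_bigr => c _.
  have [<- _] := haarE (kappa v.1 + val c * (val b * v.2)).
  by apply: eq_Rintegral => eta _; rewrite /dcos graphE.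
have sinE v : \int[m2]_p dsin (pair_dual p) v = 0.
  rewrite -(bm_Rintegral_comp mT (m1 := mu) (m2 := m2) (fun _ _ => erefl)
    measurableT (bm_dsin_pair R v)) preimage_setT muE; last first.
    exact: (bm_comp mT (bm_dsin_pair R v)).
  rewrite big1 ?mulr0 // => c _.
  have [_ <-] := haarE (kappa v.1 + val c * (val b * v.2)).
  by apply: eq_Rintegral => eta _; rewrite /dsin graphE.
apply: (fourier_unique cK cL (m1 := nu) (m2 := m2)) => -[x y]; last first.
  by rewrite sinE; have [_ ->] := coefA (x, y).
rewrite cosE /=; have [x0|x0] := eqVneq x 0.
  have [y0|y0] := eqVneq y 0.
    rewrite x0 y0 (@eq_Rintegral _ _ _ _ _ (fun=> 1)); last first.
      by move=> p _; exact: dcos0.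
    rewrite Rintegral_cst // [X in fine X](probability_setT nu) mulr1.
    under eq_bigr do rewrite rmorph0 !mulr0 addr0 eqxx.
    by rewrite big_const_seq count_predT iter_addr addr0 mulVf // lt0r_neq0.
  have [-> _] := coefA (x, y); rewrite x0 -/A A_snd // big1 ?mulr0 // => c _.
  rewrite rmorph0 add0r !mulf_eq0 (negbTE y0) (negbTE b0) !orbF.
  by rewrite (negbTE (valP c)).
have [-> _] := coefA (x, y); rewrite -/A.
have [y0|y0] := eqVneq y 0.
  rewrite y0 A_fst // big1 ?mulr0 // => c _.
  by rewrite !mulr0 addr0 (negbTE (kappa_neq0 x x0)).
rewrite A_fstE //; set z := y / kappa x.
have z0 : z != 0 by rewrite mulf_neq0 // invr_eq0 kappa_neq0.
have yE : y = z * kappa x by rewrite divfK // kappa_neq0.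
have eqE c : (kappa x + val c * (- y1^-1 * y) == 0) = (y1 == val c * z).
  rewrite yE (_ : _ + _ = kappa x / y1 * (y1 - val c * z)); last by field.
  rewrite mulf_eq0 subr_eq0 (_ : (kappa x / y1 == 0) = false) //.
  by apply/negbTE; rewrite mulf_neq0 ?invr_eq0 // kappa_neq0.
have -> : \sum_(c <- W) (kappa x + val c * (- y1^-1 * y) == 0)%:R =
    \sum_(c <- W) (y1 == val c * z)%:R :> R.
  by apply: eq_bigr => c _; rewrite eqE.
have [isg notg] := graphs z z0.
have [[c rc zc]|ng] := pselect (exists2 c, range w c & z = val c * y1).
  rewrite isg; last by exists c.
  have c0 : val c != 0 := valP c.
  have cV : (c^-1)%g \in W.
    rewrite mem_W; apply/asboolP; case: rc => k _ <-.
    by exists (k^-1)%g => //; rewrite multiplicativeV.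
  have cVE : (y1 == val (c^-1)%g * z) = true.
    by apply/eqP; rewrite zc -[val _]/(val c)^-1 mulKf.
  rewrite (bigD1_seq (c^-1)%g) ?fset_uniq //= cVE big1 ?addr0 ?mulr1 //.
  move=> c' c'c; case: eqP => // e; case/eqP: c'c; apply: val_inj.
  apply: (mulIf (_ : val c * y1 != 0)); first by rewrite mulf_neq0.
  by rewrite -zc -e; exact/eqP.
rewrite notg // big_seq big1 ?mulr0 // => c; rewrite mem_W => /asboolP rc.
have c0 : val c != 0 := valP c.
case: eqP => // e; case: ng; exists (c^-1)%g.
  by case: rc => k _ <-; exists (k^-1)%g => //; rewrite multiplicativeV.
by rewrite e -[val _]/(val c)^-1 mulKf.
Qed.

End ergodic_coupling.

(** * Invariant couplings of the actions on two dual groups *)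

Theorem theorem1p1 (R : realType) (K L : fieldType)
  (cardK : ([set: K] #= [set: nat])%card) (cardL : ([set: L] #= [set: nat])%card)
  (mK : probability (dual R K) R) (mL : probability (dual R L) R)
  (haarK : is_haar mK) (haarL : is_haar mL)
  (rho : {multiplicative units K -> units L}) (rho_bij : bijective rho)
  (ndisj : ~ disjoint_actions mK mL rho) :
  exists (w : {multiplicative units K -> units L})
         (kappa : {rmorphism K -> L}),
    [/\ finite_set (range w),
        kappa =1 twist w rho,
        bijective kappa &
        exists mu : probability (dual R K * dual R L)%type R,
          (forall f : dual R K * dual R L -> R, continuous f ->
             \int[mu]_p f p =
               #|` fset_set (range w)|%:R^-1 *
               \sum_(c \in range w)
                  \int[mL]_eta f (dual_map kappa eta, dual_scale c eta)) /\
          (forall nu : probability (dual R K * dual R L)%type R,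
             is_coupling mK mL nu ->
             invariant_measure (diag_act rho) nu ->
             ergodic_measure (diag_act rho) nu ->
             ~ trivial_coupling mK mL nu ->
             exists b : units L,
               forall A : set (dual R K * dual R L), measurable A ->
                 nu A = pushforward mu (fun p => (p.1, dual_scale b p.2)) A)].
Proof.
have cK : countable [set: K] by move: cardK; rewrite card_eq_le => /andP[].
have cL : countable [set: L] by move: cardL; rewrite card_eq_le => /andP[].
have infK : infinite_set [set: K].
  by move: cardK; rewrite card_eq_le => /andP[_] /infiniteP.
have [nu0 [nu0c nu0i nu0n]] : exists nu0 : probability (dual R K * dual R L)%type R,
    [/\ is_coupling mK mL nu0, invariant_measure (diag_act rho) nu0 &
        ~ trivial_coupling mK mL nu0].
  apply: contrapT => h; apply: ndisj => nu nuc nui; apply: contrapT => nun.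
  by apply: h; exists nu.
have [w [kappa [w_fin kappaE kappa_bij]]] :=
  coupling_isomorphism cK cL infK haarK haarL rho_bij nu0c nu0i nu0n.
exists w, kappa; split=> //.
pose g (c : units L) (eta : dual R L) := (dual_map kappa eta, dual_scale c eta).
have mg c : measurable_fun setT (g c).
  exact: measurable_fun_pair (measurable_dual_map kappa) (measurable_dual_scale c).
have W0 : (0 < size (fset_set (range w)))%N.
  rewrite cardfs_gt0; apply/fset0Pn; exists (w 1%g).
  by rewrite in_fset_set // inE; exists 1%g.
have [mu muE] := average_probability mL mg 1%g W0.
exists mu; split=> [f cf|nu nuc nui nue nun].
  rewrite muE; last exact: continuous_bounded_measurable cf.
  by rewrite fsbig_finite.
exact: (ergodic_coupling_form cK cL infK haarK haarL w_fin kappaE kappa_bij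
  nuc nue nun muE).
Qed.
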